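(* Let $\lambda,\mu>0$ and $\rho=\lambda/\mu\le e^{-1}$, and let $N$ be the stationary volume of the birth and death random tree process with parameters $\lambda,\mu$, i.e. $N=\lim_{t\to\infty}N(t)$ in distribution. Let $r\le 1$ be the smallest root of $re^{-r}=\rho$. Then the distribution of $N$ is given by \[ \mathsf{P}\{N=k\}=\frac1r\,\frac{k^{k-1}}{k!}\,\rho^k,\qquad k\ge 1, \] and the mean value of $N$ is \[ \mathsf{E}\,N=\frac{1}{1-r} \] (understood as $+\infty$ when $r=1$, i.e. $\rho=e^{-1}$).
   Context: The process $G=\{G(t),t\ge0\}$ is a continuous-time Markov chain whose state space is the set of finite directed trees rooted at a fixed vertex $v_0$. At time $0$, $G(0)$ consists of the single vertex $v_0$. Transitions: (adjunction) at each vertex $v$ of the current tree, independently, a new edge with origin $v$ and ending at a new leaf is appended at the epochs of a Poisson process of rate $\lambda>0$; (deletion) each vertex other than the root, as long as it is a leaf (has no descendant), is deleted at rate $\mu$. The root is never deleted. The process is ergodic (positive recurrent) when $\rho=\lambda/\mu\le e^{-1}$. $N(t)$ is the volume of $G(t)$, i.e. its total number of vertices (root included). *)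

(* Defs.v *)
From HB Require Import structures.
From mathcomp Require Import all_boot all_order all_algebra generic_quotient.
From mathcomp Require Import all_classical all_reals all_analysis.

Set Implicit Arguments.
Unset Strict Implicit.
Unset Printing Implicit Defensive.

Import Order.TTheory GRing.Theory Num.Theory.
Import numFieldNormedType.Exports.

Local Open Scope classical_set_scope.
Local Open Scope ring_scope.
Local Open Scope quotient_scope.

(* Finite rooted trees are represented by plane trees (the children of a
   vertex are listed in some order), which are then identified up to root
   preserving isomorphism, i.e. up to recursive reordering of the children. All
   edges are directed away from the root. *)
Inductive plane_tree := PNode of seq plane_tree.

Fixpoint plane_tree_encode (t : plane_tree) : GenTree.tree void :=
  let: PNode s := t in GenTree.Node 0 (map plane_tree_encode s).

Fixpoint plane_tree_decode (t : GenTree.tree void) : plane_tree :=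
  match t with
  | GenTree.Leaf _ => PNode [::]
  | GenTree.Node _ s => PNode (map plane_tree_decode s)
  end.

Fixpoint plane_tree_ind_foldr (Q : plane_tree -> Prop)
    (H : forall s, foldr (fun u => and (Q u)) True s -> Q (PNode s)) t : Q t :=
  let: PNode s := t in
  H s ((fix all_in s : foldr (fun u => and (Q u)) True s :=
    match s with
    | [::] => I
    | c :: s' => conj (plane_tree_ind_foldr H c) (all_in s')
    end) s).

Lemma plane_tree_encodeK : cancel plane_tree_encode plane_tree_decode.
Proof.
elim/plane_tree_ind_foldr => s IH /=; congr PNode; rewrite -map_comp.
by elim: s IH => //= c s IHs [-> /IHs ->].
Qed.

HB.instance Definition _ :=
  Countable.copy plane_tree (can_type plane_tree_encodeK).

Lemma plane_tree_ind' (Q : plane_tree -> Prop) :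
  (forall s, {in s, forall u, Q u} -> Q (PNode s)) -> forall t, Q t.
Proof.
move=> H; elim/plane_tree_ind_foldr => s IH; apply: H => u.
by elim: s IH => //= c s IHs [Qc /IHs Qs]; rewrite inE => /orP[/eqP ->|/Qs].
Qed.

Fixpoint tree_iso (t u : plane_tree) {struct t} : bool :=
  let: PNode s := t in
  let: PNode v := u in
  has (fun w => all2 tree_iso s w) (permutations v).

Lemma tree_isoP s v :
  reflect (exists2 w, perm_eq w v & all2 tree_iso s w)
          (tree_iso (PNode s) (PNode v)).
Proof.
apply: (iffP hasP) => -[w]; rewrite ?mem_permutations => wv sw; exists w => //.
by rewrite mem_permutations.
Qed.

Lemma all2_permr (T S : eqType) (r : T -> S -> bool) s s' v :
  perm_eq s s' -> all2 r s' v -> exists2 w, perm_eq w v & all2 r s w.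
Proof.
elim: s s' v => [|c s IH] s' v; first by
  rewrite perm_sym => /perm_nilP -> /=; case: v => // _; exists [::].
move=> pss'; have cs' : c \in s' by rewrite -(perm_mem pss') mem_head.
case/splitPr: cs' pss' => p1 p2.
rewrite perm_sym -cat1s perm_catCA /= perm_cons perm_sym => pss'.
rewrite all2E size_cat /= => /andP[/eqP sz].
have [v1 [b [v2 [vE sz1]]]] : exists v1 b v2, v = v1 ++ b :: v2 /\
    size p1 = size v1.
  have szv : (size p1 < size v)%N by rewrite -sz addnS ltnS leq_addr.
  case: v sz szv => // b0 v sz szv.
  exists (take (size p1) (b0 :: v)), (nth b0 (b0 :: v) (size p1)),
    (drop (size p1).+1 (b0 :: v)).
  by split; rewrite -?drop_nth ?cat_take_drop ?size_takel // ltnW.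
rewrite vE zip_cat // all_cat /= => /and3P[h1 hb h2].
have [|w pw sw] := IH (p1 ++ p2) (v1 ++ v2) pss'.
  rewrite all2E zip_cat // all_cat h1 h2 !andbT size_cat; apply/eqP.
  by apply: succn_inj; rewrite -!addnS sz vE !size_cat /= addnS.
exists (b :: w); last by rewrite /= hb.
by rewrite perm_sym -cat1s perm_catCA /= perm_cons perm_sym.
Qed.

Lemma tree_iso_refl : reflexive tree_iso.
Proof.
elim/plane_tree_ind' => s IH; apply/tree_isoP; exists s => //.
elim: s IH => //= c s IHs IH; rewrite IH ?mem_head //=.
by apply: IHs => u us; apply: IH; rewrite inE us orbT.
Qed.

Lemma tree_iso_sym : symmetric tree_iso.
Proof.
suff H t u : tree_iso t u -> tree_iso u t by move=> t u; apply/idP/idP; exact: H.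
elim/plane_tree_ind': t u => s IH [v] /tree_isoP[w wv sw].
have ws : all2 tree_iso w s.
  elim: s w IH sw {wv} => [|c s IHs] [|b w] //= IH /andP[cb sw].
  by rewrite IH ?mem_head//= IHs// => u us; apply: IH; rewrite inE us orbT.
rewrite perm_sym in wv.
have [x xs vx] := all2_permr wv ws.
by apply/tree_isoP; exists x.
Qed.

Lemma tree_iso_trans : transitive tree_iso.
Proof.
move=> t u; elim/plane_tree_ind': u t => s IH [v] [y].
move=> /tree_isoP[w wv sw] /tree_isoP[x xy vx].
have [x' x'x wx'] := all2_permr wv vx.
apply/tree_isoP; exists x'; first exact: perm_trans x'x xy.
elim: s w x' IH sw wx' {wv vx x'x} => [|c s IHs] [|b w] [|a x'] //= IH.
move=> /andP[cb sw] /andP[ba wx'].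
rewrite (IH _ (mem_head _ _) _ _ cb ba)/=; apply: IHs sw wx'.
by move=> u us; apply: IH; rewrite inE us orbT.
Qed.

Canonical tree_iso_equiv :=
  EquivRel tree_iso tree_iso_refl tree_iso_sym tree_iso_trans.

Definition tree : Type := {eq_quot tree_iso_equiv}.
HB.instance Definition _ := EqQuotient.on tree.
HB.instance Definition _ := Choice.on tree.

Fixpoint plane_volume (t : plane_tree) : nat :=
  let: PNode s := t in (sumn (map plane_volume s)).+1.

Definition volume (T : tree) : nat := plane_volume (repr T).

Definition root_tree : tree := \pi_tree (PNode [::]).

(* All the sequences obtained from s by replacing one entry c by a member of
   f c. *)
Definition replace_one (A : Type) (f : A -> seq A) : seq A -> seq (seq A) :=
  fix replace s := match s with
    | [::] => [::]
    | c :: s' => [seq b :: s' | b <- f c] ++ [seq c :: s'' | s'' <- replace s']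
  end.

(* The trees obtained from t by attaching a new leaf to one of its vertices:
   one entry for each vertex of t, so that repetitions are significant. *)
Fixpoint adjunctions (t : plane_tree) : seq plane_tree :=
  let: PNode s := t in
  PNode (PNode [::] :: s) ::
    [seq PNode s' | s' <- replace_one adjunctions s].

Definition remove_leaf (s : seq plane_tree) : seq (seq plane_tree) :=
  [seq take i s ++ drop i.+1 s
  | i <- iota 0 (size s) & nth (PNode [::]) s i == PNode [::]].

(* The trees obtained from t by deleting one of its leaves other than the root:
   one entry for each such leaf. The first part lists the deletions of a child
   of the root, the second one those of a deeper leaf. *)
Fixpoint deletions (t : plane_tree) : seq plane_tree :=
  let: PNode s := t in
  [seq PNode s' | s' <- remove_leaf s] ++
    [seq PNode s' | s' <- replace_one deletions s].

(* Off-diagonal entries of the Q-matrix of the chain: every vertex gives birth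
   to a new leaf at rate lambda, every leaf other than the root dies at rate
   mu. The value does not depend on the plane representative of S. *)
Definition jump_rate (R : realType) (lambda mu : R) (S T : tree) : R :=
  lambda * (count (fun u => \pi_tree u == T) (adjunctions (repr S)))%:R +
  mu * (count (fun u => \pi_tree u == T) (deletions (repr S)))%:R.

Definition exit_rate (R : realType) (lambda mu : R) (S : tree) : R :=
  lambda * (size (adjunctions (repr S)))%:R +
  mu * (size (deletions (repr S)))%:R.

Definition Qmatrix (R : realType) (lambda mu : R) (S T : tree) : R :=
  if T == S then - exit_rate lambda mu S else jump_rate lambda mu S T.

Record is_transition_function (R : realType) (Q : tree -> tree -> R)
    (p : R -> tree -> tree -> R) : Prop := {
  transition_ge0 : forall t S T, 0 <= t -> 0 <= p t S T ;
  transition_sum1 : forall t S, 0 <= t ->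
    (\esum_(T in [set: tree]) (p t S T)%:E = 1)%E ;
  transition0 : forall S T, p 0 S T = (S == T)%:R ;
  transitionD : forall s t S T, 0 <= s -> 0 <= t ->
    ((p (s + t) S T)%:E = \esum_(U in [set: tree]) (p s S U * p t U T)%:E)%E ;
  transition_derivative : forall S T,
    (p h S T - p 0 S T) / h @[h --> 0^'+] --> Q S T }.

(* G is a continuous-time Markov chain with Q-matrix Q started from S0,
   described by its finite-dimensional distributions. Only the values G t with
   0 <= t are relevant. *)
Definition is_Markov_chain d (Omega : measurableType d) (R : realType)
    (P : probability Omega R) (Q : tree -> tree -> R) (S0 : tree)
    (G : R -> Omega -> tree) : Prop :=
  (forall t T, 0 <= t -> measurable (G t @^-1` [set T])) /\
  exists2 p : R -> tree -> tree -> R, is_transition_function Q p &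
    forall (n : nat) (t : nat -> R) (S : nat -> tree),
      t 0%N = 0 -> (forall i, t i <= t i.+1) -> S 0%N = S0 ->
      P [set w | forall i, (i <= n)%N -> G (t i) w = S i] =
      (\prod_(i < n) p (t i.+1 - t i) (S i) (S i.+1))%:E.

Definition is_birth_death_tree d (Omega : measurableType d) (R : realType)
    (P : probability Omega R) (lambda mu : R) (G : R -> Omega -> tree) : Prop :=
  is_Markov_chain P (Qmatrix lambda mu) root_tree G.

Definition cvg_in_distribution (R : realType)
    d (Omega : measurableType d) (P : probability Omega R) (X : R -> Omega -> R)
    d' (Omega' : measurableType d') (P' : probability Omega' R)
    (Y : Omega' -> R) : Prop :=
  forall f : R -> R, continuous f -> bounded_fun f ->
    'E_P[f \o X t]%E @[t --> +oo] --> 'E_P'[f \o Y]%E.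

(* Y is distributed as the limit of the volume N(t) of the tree G(t). *)
Definition is_stationary_volume (R : realType)
    d (Omega : measurableType d) (P : probability Omega R)
    (G : R -> Omega -> tree)
    d' (Omega' : measurableType d') (P' : probability Omega' R)
    (Y : Omega' -> R) : Prop :=
  cvg_in_distribution P (fun t w => (volume (G t w))%:R) P' Y.

Definition is_smallest_root (R : realType) (rho r : R) : Prop :=
  r * expR (- r) = rho /\ forall s, s * expR (- s) = rho -> r <= s.

(* Main.v *)
(* Give a plane tree with vertices of out-degrees d_v the weight
   prod_v rho / d_v!, so that an isomorphism class T of trees gets the mass
   rho^|T| / |Aut T|. Attaching a leaf and deleting a leaf are inverse to each
   other, which makes this mass reversible for the jump rates. The total mass A
   satisfies A = rho exp A and is the smallest solution r; the mean M of the
   volume satisfies M = A + M A; the mass of the trees with k vertices follows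
   by removing the root of the first tree of an ordered forest, which gives a
   recursion solved by the binomial theorem.

   Reversibility passes from the rates to any transition function p with these
   rates: the derivative in s of sum_U pi(U) p_s(U, S) p_(t-s)(U, T), the sum
   being over the trees with at most n vertices, is bounded by the flux
   lambda n P(N = n) through the trees with n vertices, whose lower limit is 0
   because the P(N = n) are summable.

   For the convergence, let u_t be the density of p_t(root, .) with respect to
   pi and phi(t) = u_t(root). The sum over all S and T of
   pi(S) p_h(S, T) (u_t(S) - u_t(T))^2 equals 2 (phi(2t) - phi(2t + h)); hence
   phi is nonincreasing, has a limit, and u_t(S) - u_t(T) tends to 0 along every
   edge S, T, so u_t converges to a constant, which is 1 by conservation of
   mass. *)

Require Import Defs.
From HB Require Import structures.
From mathcomp Require Import all_boot all_order all_algebra generic_quotient.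
From mathcomp Require Import all_classical all_reals all_analysis.
From mathcomp Require Import measurable_realfun ring lra zify.

Set Implicit Arguments.
Unset Strict Implicit.
Unset Printing Implicit Defensive.

Import Order.TTheory GRing.Theory Num.Theory.
Import numFieldNormedType.Exports.

Local Open Scope classical_set_scope.
Local Open Scope ring_scope.
Local Open Scope quotient_scope.

(** * Moves of plane trees *)

(** The exit rates are unbounded, and a transition function is only known to have right derivatives
    at time 0; neither the Kolmogorov equations at positive times nor the uniqueness of [p] is used.
    Hence reversibility is shown for an arbitrary [p], on finitely many trees, with increments over
    short steps in place of derivatives. The harmonic series diverges, so summability alone makes n
    P(N = n) small for infinitely many n: the case r = 1 needs no asymptotics of k^(k-1)/k!.

    A class T has prod_v d_v! / |Aut T| plane representatives, so adding the weights over
    representatives yields 1/|Aut T| with no count of automorphisms. New leaves are attached in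
    front while deletions strike anywhere, so the two kinds of moves are inverse only up to
    isomorphism; the sums are therefore taken of isomorphism-invariant functions, and a marked child
    is moved to the front of its forest.

    The limit constant is 1 because of a domination: reversibility and p <= 1 give p_t(root, T) <=
    pi(T) / pi(root), so no mass escapes to large trees. *)

Notation leaf := (PNode [::]).

Section Picks.
Variable A : eqType.
Implicit Types s : seq A.

(** The marked entry is cut loose from its position. Sums over positions in a forest, as in
    [replace_one] and [remove_leaf], become sums of functions of one tree and of a rest whose order
    will not matter. *)
Fixpoint picks s : seq (A * seq A) :=
  if s is c :: s' then (c, s') :: [seq (x.1, c :: x.2) | x <- picks s']
  else [::].

Lemma picksE d s : picks s =
  [seq (nth d s i, take i s ++ drop i.+1 s) | i <- iota 0 (size s)].
Proof.
elim: s => //= c s ->; rewrite drop0; congr cons.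
by rewrite -[1%N]addn0 iotaDl -!map_comp; apply: eq_map => i /=.
Qed.

Lemma perm_picks s x : x \in picks s -> perm_eq s (x.1 :: x.2).
Proof.
elim: s x => //= c s IH x; rewrite inE => /predU1P[->//|/mapP[y /IH py ->]] /=.
by rewrite perm_sym -cat1s -[c :: y.2]cat1s perm_catCA perm_cons perm_sym.
Qed.

Section Big.
Variables (V : Type) (idx : V) (op : Monoid.com_law idx).

Lemma big_picks_cons (phi : A -> seq A -> V) c s :
  \big[op/idx]_(x <- picks (c :: s)) phi x.1 x.2 =
  op (phi c s) (\big[op/idx]_(x <- picks s) phi x.1 (c :: x.2)).
Proof. by rewrite /= big_cons big_map. Qed.

(** Induction on [s]: [move_head] brings to the front of [v] the entry equal to the head of [s]. For
    the tails, [phi] is replaced by [phi] with that head added to the rest, which is still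
    invariant. *)
Lemma big_picks_perm (phi : A -> seq A -> V) s v :
  (forall c r r', perm_eq r r' -> phi c r = phi c r') -> perm_eq s v ->
  \big[op/idx]_(x <- picks s) phi x.1 x.2 =
  \big[op/idx]_(x <- picks v) phi x.1 x.2.
Proof.
have move_head p q c (psi : A -> seq A -> V) :
    (forall c r r', perm_eq r r' -> psi c r = psi c r') ->
    \big[op/idx]_(x <- picks (p ++ c :: q)) psi x.1 x.2 =
    \big[op/idx]_(x <- picks (c :: p ++ q)) psi x.1 x.2.
  elim: p psi => // b p IH psi psiP; rewrite cat_cons [in LHS]big_picks_cons.
  rewrite (IH (fun e r => psi e (b :: r))); last first.
    by move=> e r r' rr'; apply: psiP; rewrite perm_cons.
  rewrite (big_picks_cons (fun e r => psi e (b :: r))) !big_picks_cons.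
  rewrite (big_picks_cons (fun e r => psi e (c :: r))).
  rewrite Monoid.mulmCA; congr (op _ (op _ _)).
    by apply: psiP; rewrite -(cat1s c) perm_catCA.
  apply: eq_bigr => x _; apply: psiP.
  by rewrite -[b :: c :: _]cat1s -[c :: x.2]cat1s perm_catCA.
elim: s v phi => [|c s IH] v phi phiP sv.
  by rewrite perm_sym in sv; rewrite (perm_nilP sv).
have cv : c \in v by rewrite -(perm_mem sv) mem_head.
case/splitPr: cv sv => p q; rewrite perm_sym -cat1s perm_catCA /= perm_cons.
rewrite perm_sym => sv; rewrite move_head// !big_picks_cons.
congr (op _ _); first exact: phiP.
by apply: (IH _ (fun e r => phi e (c :: r))) => // e r r' rr'; apply: phiP;
  rewrite perm_cons.
Qed.

(** As [G] ignores the order, the replaced entry may be moved to the front. *)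
Lemma big_replace_one (f : A -> seq A) (G : seq A -> V) s :
  (forall r r', perm_eq r r' -> G r = G r') ->
  \big[op/idx]_(s' <- replace_one f s) G s' =
  \big[op/idx]_(x <- picks s) \big[op/idx]_(b <- f x.1) G (b :: x.2).
Proof.
elim: s G => [|c s IH] G GP; first by rewrite !big_nil.
rewrite /= big_cons big_cat !big_map /=; congr (op _ _).
rewrite (IH (fun r => G (c :: r))) => [|r r' rr']; last first.
  by apply: GP; rewrite perm_cons.
apply: eq_bigr => x _; apply: eq_bigr => b _; apply: GP.
by rewrite -[c :: b :: _]cat1s -[b :: x.2]cat1s perm_catCA.
Qed.

End Big.

Lemma mem_replace_one (f : A -> seq A) s s' : s' \in replace_one f s ->
  exists p c q b, [/\ s = p ++ c :: q, b \in f c & s' = p ++ b :: q].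
Proof.
elim: s s' => //= c s IH s'; rewrite mem_cat => /orP[/mapP[b bc ->]|].
  by exists [::], c, s, b.
move=> /mapP[s'' /IH[p [c' [q [b [-> bc' ->]]]]] ->].
by exists (c :: p), c', q, b.
Qed.

End Picks.

Lemma remove_leafE s :
  remove_leaf s = [seq x.2 | x <- picks s & x.1 == leaf].
Proof. by rewrite (picksE leaf) filter_map -map_comp. Qed.

Lemma tree_iso_perm s v : perm_eq s v -> tree_iso (PNode s) (PNode v).
Proof.
move=> sv; apply/tree_isoP; exists s => //.
by elim: s {sv} => //= c s ->; rewrite tree_iso_refl.
Qed.

Lemma tree_iso_cons c c' s s' : tree_iso c c' ->
  tree_iso (PNode s) (PNode s') -> tree_iso (PNode (c :: s)) (PNode (c' :: s')).
Proof.
move=> cc' /tree_isoP[w ws sw]; apply/tree_isoP; exists (c' :: w).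
  by rewrite perm_cons.
by rewrite /= cc'.
Qed.

Lemma tree_iso_leaf c c' : tree_iso c c' -> (c == leaf) = (c' == leaf).
Proof.
case: c c' => [s] [v] /tree_isoP[w wv].
have sz : size w = size v by apply: perm_size.
rewrite all2E => /andP[/eqP ss _].
have {ss}sz : size s = size v by rewrite ss.
have E r : (PNode r == leaf) = (size r == 0)%N.
  by apply/eqP/eqP => [[->]//|/size0nil ->].
by rewrite !E sz.
Qed.

Section BigMoves.
Variables (V : Type) (idx : V) (op : Monoid.com_law idx).

Lemma big_picks_iso (phi : plane_tree -> seq plane_tree -> V) s v :
  (forall c r r', perm_eq r r' -> phi c r = phi c r') ->
  (forall c c' r r', c \in s -> tree_iso c c' ->
     tree_iso (PNode r) (PNode r') -> phi c r = phi c' r') ->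
  tree_iso (PNode s) (PNode v) ->
  \big[op/idx]_(x <- picks s) phi x.1 x.2 =
  \big[op/idx]_(x <- picks v) phi x.1 x.2.
Proof.
move=> phiP phiI /tree_isoP[w wv sw]; rewrite -(big_picks_perm _ _ wv)//.
(* The two sides get separate functions: in the induction one receives the head of [s], the other
   the head of [w], and these are isomorphic but not equal. *)
move: phiI; move: {2 4}phi => psi; move: phi {phiP wv} => phi.
elim: s w phi psi sw => [|c s IH] [|b w]// phi psi => [_ _|].
  by rewrite !big_nil.
move=> /= /andP[cb sw] phiI; rewrite !big_cons !big_map /=; congr (op _ _).
  by apply: phiI; rewrite ?mem_head//; apply/tree_isoP; exists w.
apply: (IH _ (fun e r => phi e (c :: r)) (fun e r => psi e (b :: r))) => //.
move=> e e' r r' es ee' rr'; apply: phiI; rewrite ?inE ?es ?orbT//.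
exact: tree_iso_cons.
Qed.

Section Invariant.
Variable F : plane_tree -> V.
Hypothesis FI : forall t u, tree_iso t u -> F t = F u.

Lemma big_adjunctions s :
  \big[op/idx]_(u <- adjunctions (PNode s)) F u =
  op (F (PNode (leaf :: s)))
     (\big[op/idx]_(x <- picks s) \big[op/idx]_(b <- adjunctions x.1)
        F (PNode (b :: x.2))).
Proof.
rewrite /= big_cons big_map; congr (op _ _).
apply: (big_replace_one _ _ (G := fun r => F (PNode r))).
by move=> r r' rr'; apply: FI; exact: tree_iso_perm.
Qed.

Lemma big_deletions s :
  \big[op/idx]_(u <- deletions (PNode s)) F u =
  op (\big[op/idx]_(x <- picks s | x.1 == leaf) F (PNode x.2))
     (\big[op/idx]_(x <- picks s) \big[op/idx]_(b <- deletions x.1)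
        F (PNode (b :: x.2))).
Proof.
rewrite /= remove_leafE big_cat !big_map big_filter; congr (op _ _).
apply: (big_replace_one _ _ (G := fun r => F (PNode r))).
by move=> r r' rr'; apply: FI; exact: tree_iso_perm.
Qed.

End Invariant.

(** The rates are read off [repr S]; this allows any other representative in its place. [F] is
    general in the induction because the moves of a child [c] are seen through [b] mapped to
    [F (PNode (b :: r))]. *)
Lemma big_adjunctions_iso (F : plane_tree -> V) t t' :
  (forall u v, tree_iso u v -> F u = F v) -> tree_iso t t' ->
  \big[op/idx]_(u <- adjunctions t) F u =
  \big[op/idx]_(u <- adjunctions t') F u.
Proof.
elim/plane_tree_ind': t t' F => s IH [v] F FI sv; rewrite !big_adjunctions//.
congr (op _ _); first by apply/FI/tree_iso_cons.
apply: (big_picks_iso (phi := fun c r =>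
  \big[op/idx]_(b <- adjunctions c) F (PNode (b :: r)))) => //.
  move=> c r r' rr'; apply: eq_bigr => b _; apply/FI/tree_iso_perm.
  by rewrite perm_cons.
move=> c c' r r' cs cc' rr'.
rewrite (IH _ cs c' (fun b => F (PNode (b :: r))))//; last first.
  by move=> u w uw; apply/FI/tree_iso_cons => //; apply: tree_iso_refl.
by apply: eq_bigr => b _; apply/FI/tree_iso_cons => //; apply: tree_iso_refl.
Qed.

Lemma big_deletions_iso (F : plane_tree -> V) t t' :
  (forall u v, tree_iso u v -> F u = F v) -> tree_iso t t' ->
  \big[op/idx]_(u <- deletions t) F u = \big[op/idx]_(u <- deletions t') F u.
Proof.
elim/plane_tree_ind': t t' F => s IH [v] F FI sv; rewrite !big_deletions//.
congr (op _ _).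
  rewrite big_mkcond [RHS]big_mkcond.
  apply: (big_picks_iso (phi := fun c r =>
    if c == leaf then F (PNode r) else idx)) => //.
    by move=> c r r' rr'; case: ifP => // _; apply/FI/tree_iso_perm.
  move=> c c' r r' _ cc' rr'; rewrite (tree_iso_leaf cc').
  by case: ifP => // _; exact: FI.
apply: (big_picks_iso (phi := fun c r =>
  \big[op/idx]_(b <- deletions c) F (PNode (b :: r)))) => //.
  move=> c r r' rr'; apply: eq_bigr => b _; apply/FI/tree_iso_perm.
  by rewrite perm_cons.
move=> c c' r r' cs cc' rr'.
rewrite (IH _ cs c' (fun b => F (PNode (b :: r))))//; last first.
  by move=> u w uw; apply/FI/tree_iso_cons => //; apply: tree_iso_refl.
by apply: eq_bigr => b _; apply/FI/tree_iso_cons => //; apply: tree_iso_refl.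
Qed.

End BigMoves.

Lemma plane_volume_gt0 t : (0 < plane_volume t)%N.
Proof. by case: t. Qed.

Lemma plane_volume_iso t u : tree_iso t u -> plane_volume t = plane_volume u.
Proof.
elim/plane_tree_ind': t u => s IH [v] /tree_isoP[w wv sw] /=; congr S.
rewrite -(perm_sumn (perm_map plane_volume wv)).
elim: s w IH sw {wv} => [|c s IHs] [|b w]//= IH /andP[cb sw].
rewrite (IH c (mem_head _ _) _ cb) (IHs w)// => u us.
by apply: IH; rewrite inE us orbT.
Qed.

Lemma plane_volume_adjunctions t u :
  u \in adjunctions t -> plane_volume u = (plane_volume t).+1.
Proof.
elim/plane_tree_ind': t u => s IH u; rewrite /= inE => /predU1P[->/=|].
  by rewrite add1n.
move=> /mapP[s' /mem_replace_one[p [c [q [b [sE bc ->]]]]] ->] /=.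
rewrite sE !map_cat !sumn_cat /= (IH c _ _ bc) ?sE ?mem_cat ?mem_head ?orbT//.
by rewrite !(addnS, addSn).
Qed.

Lemma plane_volume_deletions t u :
  u \in deletions t -> (plane_volume u).+1 = plane_volume t.
Proof.
elim/plane_tree_ind': t u => s IH u; rewrite /= mem_cat => /orP[].
  rewrite remove_leafE => /mapP[s' /mapP[x]]; rewrite mem_filter.
  move=> /andP[/eqP xl /perm_picks sx] -> -> /=.
  by rewrite (perm_sumn (perm_map plane_volume sx)) /= xl.
move=> /mapP[s' /mem_replace_one[p [c [q [b [sE bc ->]]]]] ->] /=.
rewrite sE !map_cat !sumn_cat /= -(IH c _ _ bc) ?sE ?mem_cat ?mem_head ?orbT//.
by rewrite !(addnS, addSn).
Qed.

Lemma size_replace_one (A : Type) (f : A -> seq A) s :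
  size (replace_one f s) = sumn (map (size \o f) s).
Proof. by elim: s => //= c s IH; rewrite size_cat !size_map IH. Qed.

Lemma size_adjunctions t : size (adjunctions t) = plane_volume t.
Proof.
elim/plane_tree_ind': t => s IH /=; rewrite size_map size_replace_one.
congr (sumn _).+1; exact/eq_in_map.
Qed.

(** Follow first children: the first child is a leaf, which can be deleted, or the induction
    hypothesis gives a deletion inside it. *)
Lemma deletions_neq0 t : (1 < plane_volume t)%N -> deletions t != [::].
Proof.
elim/plane_tree_ind': t => -[|c s] IH //= _.
rewrite -size_eq0 size_cat !size_map /= size_cat !size_map addn_eq0 addn_eq0.
case: (ltnP 1 (plane_volume c)) => [c1|c1].
  by rewrite (size_eq0 (deletions c)) (negbTE (IH c (mem_head _ _) c1)) andbF.
case: c c1 {IH} => -[|b r] //= c1; last first.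
  by move: c1; rewrite ltnS leqNgt addn_gt0 plane_volume_gt0.
Qed.

(** * Unordered sums *)

Section EsumExtra.
Variable R : realType.
Local Open Scope ereal_scope.

Lemma esumZl (T : choiceType) (D : set T) (c : R) (f : T -> \bar R) :
  (0 <= c)%R -> (forall x, 0 <= f x) ->
  \esum_(x in D) (c%:E * f x) = c%:E * \esum_(x in D) f x.
Proof.
move=> c0 f0; rewrite /esum -ereal_supZl//; last first.
  apply/set0P; exists (\sum_(x \in set0) f x).
  by exists set0; [exact: fsets_set0|].
congr ereal_sup; apply/seteqP; split => [_ [X DX <-]|_ [_ [X DX <-] <-]].
  by exists (\sum_(x \in X) f x); [exists X|rewrite ge0_mule_fsumr].
by exists X => //; rewrite ge0_mule_fsumr.
Qed.

Lemma esumZr (T : choiceType) (D : set T) (c : R) (f : T -> \bar R) :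
  (0 <= c)%R -> (forall x, 0 <= f x) ->
  \esum_(x in D) (f x * c%:E) = (\esum_(x in D) f x) * c%:E.
Proof.
by move=> c0 f0; rewrite muleC -esumZl//; apply: eq_esum => x _; rewrite muleC.
Qed.

Lemma esum_exchange (T U : choiceType) (f : T -> U -> \bar R) :
  (forall x y, 0 <= f x y) ->
  \esum_(x in [set: T]) \esum_(y in [set: U]) f x y =
  \esum_(y in [set: U]) \esum_(x in [set: T]) f x y.
Proof.
move=> f0; rewrite !esum_esum//.
rewrite (reindex_esum ([set: U] `*`` fun=> setT) _ (fun k => (k.2, k.1)))//.
split => //=.
  by move=> [a b] [c d] _ _ [-> ->].
by move=> [a b] _; exists (b, a).
Qed.

Lemma esum_fiber (T U : choiceType) (g : T -> U) (f : T -> \bar R) :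
  (forall x, 0 <= f x) ->
  \esum_(x in [set: T]) f x =
  \esum_(y in [set: U]) \esum_(x in g @^-1` [set y]) f x.
Proof.
move=> f0; rewrite esum_esum//; apply: reindex_esum; split => //=.
  by move=> [a b] [c d]; rewrite !inE /= => -[_ <-] [_ <-] <-.
by move=> x _; exists (g x, x).
Qed.

Lemma esum_fin_ge (T : choiceType) (f : T -> \bar R) (s : seq T) :
  uniq s -> (forall x, 0 <= f x) ->
  \sum_(x <- s) f x <= \esum_(x in [set: T]) f x.
Proof.
move=> us f0; apply: esum_ge; exists [set` s]; first by split.
by rewrite -fsbig_seq.
Qed.

Lemma esum_term_le (T : choiceType) (f : T -> \bar R) x :
  (forall x, 0 <= f x) -> f x <= \esum_(x in [set: T]) f x.
Proof.
move=> f0; have -> : f x = \sum_(y <- [:: x]) f y by rewrite big_seq1.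
exact: esum_fin_ge.
Qed.

Lemma esum_fin_supp (T : choiceType) (f : T -> \bar R) (s : seq T) :
  uniq s -> (forall x, 0 <= f x) -> (forall x, x \notin s -> f x = 0) ->
  \esum_(x in [set: T]) f x = \sum_(x <- s) f x.
Proof.
move=> us f0 fs; rewrite (fsbig_seq _ _ us) -esum_fset// [RHS]esum_mkcond.
apply: eq_esum => x _; case: ifPn => // /negP xs; apply: fs.
by apply/negP => xs'; apply: xs; rewrite inE.
Qed.

Lemma esum_unique (T : choiceType) (f : T -> \bar R) x0 :
  (forall x, 0 <= f x) -> (forall x, x != x0 -> f x = 0) ->
  \esum_(x in [set: T]) f x = f x0.
Proof.
move=> f0 fx; rewrite (@esum_fin_supp _ f [:: x0])//; first by rewrite big_seq1.
by move=> x; rewrite inE; exact: fx.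
Qed.

Lemma esum_split (T : choiceType) (f : T -> R) (s : seq T) :
  uniq s -> (forall x, 0 <= f x)%R ->
  \esum_(x in [set: T]) (f x)%:E =
  (\sum_(x <- s) f x)%:E + \esum_(x in ~` [set` s]) (f x)%:E.
Proof.
move=> us f0; rewrite (esumID [set` s]) ?setTI => [|x _]; last first.
  by rewrite lee_fin.
congr (_ + _); rewrite esum_fset; [|exact: finite_seq|]; last first.
  by move=> x _; rewrite lee_fin.
by rewrite -fsbig_seq// sumEFin.
Qed.

(** A finite set of indices lies in one level of [v]. Bounds obtained by induction on a volume
    cutoff thus pass to the full sum. *)
Lemma esum_le_filtration (T : choiceType) (v : T -> nat) (f : T -> \bar R) b :
  (forall x, 0 <= f x) ->
  (forall k, \esum_(x in [set x | (v x <= k)%N]) f x <= b) ->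
  \esum_(x in [set: T]) f x <= b.
Proof.
move=> f0 fb; apply: ub_ereal_sup => _ [X [/finite_seqP[s ->] _] <-].
apply: le_trans (fb (\max_(x <- s) v x)); apply: esum_ge.
exists [set` s] => //; split => // x /= xs.
exact: (leq_bigmax_seq (F := v)).
Qed.

Lemma esum_cons (T : choiceType) (g : seq T -> \bar R) :
  (forall s, 0 <= g s) ->
  \esum_(s in [set: seq T]) g s = g [::] +
  \esum_(c in [set: T]) \esum_(s in [set: seq T]) g (c :: s).
Proof.
move=> g0; rewrite esum_esum// (esumID [set [::]])//; congr (_ + _).
  by rewrite setTI esum_set1.
apply: reindex_esum; split => /=.
- by move=> [c s] _ /=; split.
- by move=> [a b] [c d] _ _ [-> ->].
- by case=> [|c s] [_]//= _; exists (c, s).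
Qed.

(** Used when a root is removed: [s] lists its children, in any number, and [v] the [m] other trees
    of the forest; cutting at the fixed length of [v] recovers both. *)
Lemma esum_cat (T : choiceType) m (g : seq T -> seq T -> \bar R) :
  (forall s v, 0 <= g s v) ->
  \esum_(s in [set: seq T]) \esum_(v in [set v | size v = m]) g s v =
  \esum_(w in [set w | (m <= size w)%N])
    g (take (size w - m) w) (drop (size w - m) w).
Proof.
move=> g0; rewrite esum_esum//; apply/esym.
rewrite [RHS](_ : _ = \esum_(k in setT `*`` (fun=> [set v | size v = m]))
   (fun w => g (take (size w - m) w) (drop (size w - m) w)) (k.1 ++ k.2)).
  apply: reindex_esum; split => /=.
  - by move=> [s v] [_ /= vm]; rewrite size_cat vm leq_addl.
  - move=> [a b] [c d]; rewrite !inE /= => -[_ bm] [_ dm] /eqP.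
    (* Only the suffixes are known to have equal lengths, so the concatenations are compared after
       reversal. *)
    rewrite -[a ++ b]revK -[c ++ d]revK (inj_eq (can_inj revK)).
    by rewrite !rev_cat eqseq_cat ?size_rev ?bm// !(inj_eq (can_inj revK)) =>
      /andP[/eqP-> /eqP->].
  - move=> w mw; exists (take (size w - m) w, drop (size w - m) w) => /=.
      by rewrite size_drop subKn.
    by rewrite cat_take_drop.
apply: eq_esum => -[s v] [_ /= <-].
by rewrite size_cat addnK take_size_cat// drop_size_cat.
Qed.

Lemma esum_prod_size (T : choiceType) (q : T -> R) (a : R) n :
  (forall x, 0 <= q x)%R -> \esum_(x in [set: T]) (q x)%:E = a%:E ->
  \esum_(s in [set s | size s = n]) (\prod_(x <- s) q x)%:E = (a ^+ n)%:E.
Proof.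
move=> q0 qa; have a0 : (0 <= a)%R.
  by rewrite -lee_fin -qa esum_ge0// => x _; rewrite lee_fin.
have p0 s : 0 <= (\prod_(x <- s) q x)%:E by rewrite lee_fin prodr_ge0.
elim: n => [|n IH].
  rewrite (_ : [set s | _] = [set [::]]) ?esum_set1 ?big_nil//.
  by apply/seteqP; split => s /= => [/size0nil|->].
rewrite esum_mkcond esum_cons; last by move=> s; case: ifP.
rewrite memNset//= add0e.
transitivity (\esum_(c in [set: T]) (q c)%:E * (a ^+ n)%:E).
  apply: eq_esum => c _; rewrite -IH -esumZl// [RHS]esum_mkcond.
  apply: eq_esum => s _; rewrite big_cons EFinM.
  have [[sn]|sn] := pselect (size s = n).
    by rewrite !mem_set//= sn.
  by rewrite !memNset//= => -[].
by rewrite esumZr ?exprn_ge0// qa -EFinM exprS.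
Qed.

(** Lists of length n contribute a^n / n!, so the sum is the exponential series itself. This is
    where A = rho exp A comes from. *)
Lemma esum_prod_exp (T : choiceType) (q : T -> R) (a : R) :
  (forall x, 0 <= q x)%R -> \esum_(x in [set: T]) (q x)%:E = a%:E ->
  \esum_(s in [set: seq T]) ((\prod_(x <- s) q x) / (size s)`!%:R)%:E =
  (expR a)%:E.
Proof.
move=> q0 qa; have a0 : (0 <= a)%R.
  by rewrite -lee_fin -qa esum_ge0// => x _; rewrite lee_fin.
have p0 s : (0 <= \prod_(x <- s) q x)%R by rewrite prodr_ge0.
rewrite (esum_fiber (@size T)); last first.
  by move=> s; rewrite lee_fin divr_ge0.
transitivity (\esum_(n in [set: nat]) (exp_coeff a n)%:E).
  apply: eq_esum => n _; rewrite /exp_coeff /= EFinM.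
  rewrite -(esum_prod_size n q0 qa) -esumZr//.
  by apply: eq_esum => s /= ->; rewrite EFinM.
rewrite -nneseries_esumT; last by move=> n; rewrite lee_fin exp_coeff_ge0.
rewrite /expR -EFin_lim; last exact: is_cvg_series_exp_coeff.
congr (lim (_ @ \oo)); apply/funext => n /=.
by rewrite sumEFin.
Qed.

End EsumExtra.

(** * Weights of plane trees and detailed balance *)

Lemma nth_cat_mid (T : Type) (d : T) c p q i : i = size p ->
  nth d (p ++ c :: q) i = c.
Proof. by move=> ->; rewrite nth_cat ltnn subnn. Qed.

Definition forest_volume (s : seq plane_tree) := sumn (map plane_volume s).

Section Weight.
Variables (R : realType) (rho : R).
Hypothesis rho_gt0 : 0 < rho.

Fixpoint weight (t : plane_tree) : R :=
  let: PNode s := t in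
  rho * ((\prod_(x <- map weight s) x) / (size s)`!%:R).

Definition forest_weight (s : seq plane_tree) : R :=
  (\prod_(c <- s) weight c) / (size s)`!%:R.

Lemma weightE s : weight (PNode s) = rho * forest_weight s.
Proof. by rewrite /= big_map. Qed.

Lemma weight_gt0 t : 0 < weight t.
Proof.
elim/plane_tree_ind': t => s IH; rewrite weightE mulr_gt0// divr_gt0//.
  elim: s IH => [|c s IHs] IH; first by rewrite big_nil.
  rewrite big_cons mulr_gt0 ?IH ?mem_head// IHs// => u us.
  by apply: IH; rewrite inE us orbT.
Qed.

Lemma weight_ge0 t : 0 <= weight t. Proof. exact/ltW/weight_gt0. Qed.

Lemma prod_weight_ge0 s : 0 <= \prod_(c <- s) weight c.
Proof. by rewrite prodr_ge0// => c _; exact: weight_ge0. Qed.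

Lemma forest_weight_ge0 s : 0 <= forest_weight s.
Proof. by rewrite divr_ge0// prod_weight_ge0. Qed.

Lemma weight_leaf : weight leaf = rho.
Proof. by rewrite weightE /forest_weight big_nil fact0 divr1 mulr1. Qed.

Local Open Scope ereal_scope.

Lemma esum_PNode (f : plane_tree -> \bar R) :
  \esum_(t in [set: plane_tree]) f t =
  \esum_(s in [set: seq plane_tree]) f (PNode s).
Proof.
apply: reindex_esum; split => //=; first by move=> s v _ _ [].
by case=> s _; exists s.
Qed.

(* Each pair of a tree c and a forest s arises from the (size s).+1 insertions
   of c into s, and each of the resulting forests has weight
   weight c * forest_weight s / (size s).+1. *)
Lemma esum_picks (phi : plane_tree -> seq plane_tree -> \bar R) :
  (forall c s, 0 <= phi c s) ->
  \esum_(s in [set: seq plane_tree])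
    ((forest_weight s)%:E * \sum_(x <- picks s) phi x.1 x.2) =
  \esum_(c in [set: plane_tree])
    ((weight c)%:E * \esum_(s in [set: seq plane_tree])
       ((forest_weight s)%:E * phi c s)).
Proof.
move=> phi0; have w0 := weight_ge0; have fw0 := forest_weight_ge0.
pose psi s i : \bar R := (forest_weight s)%:E *
  phi (nth leaf s i) (take i s ++ drop i.+1 s).
have psi0 s i : 0 <= psi s i by rewrite mule_ge0// lee_fin.
transitivity (\esum_(s in [set: seq plane_tree])
    \esum_(i in [set i | (i < size s)%N]) psi s i).
  apply: eq_esum => s _; rewrite ge0_sume_distrr//.
  rewrite (picksE leaf) big_map.
  rewrite [RHS]esum_mkcond.
  rewrite (@esum_fin_supp _ _ _ (iota 0 (size s))) ?iota_uniq//.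
  - rewrite big_seq [RHS]big_seq; apply: eq_bigr => i.
    by rewrite mem_iota => si; rewrite mem_set.
  - by move=> i; case: ifP.
  - by move=> i; rewrite mem_iota => si; rewrite memNset//; apply/negP.
transitivity (\esum_(c in [set: plane_tree]) \esum_(s in [set: seq plane_tree])
    \esum_(i in [set i | (i <= size s)%N])
      ((weight c)%:E * ((forest_weight s)%:E * phi c s) *
       ((size s).+1%:R^-1)%:E)).
  rewrite (eq_esum (b := fun c => \esum_(k in [set: seq plane_tree] `*``
      (fun s => [set i | (i <= size s)%N]))
      ((weight c)%:E * ((forest_weight k.1)%:E * phi c k.1) *
       ((size k.1).+1%:R^-1)%:E))); last first.
    move=> c _; rewrite esum_esum// => s i _ _.
    by rewrite !mule_ge0// lee_fin// invr_ge0.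
  rewrite !esum_esum//; last first.
    by move=> c s _ _; rewrite !mule_ge0// lee_fin// invr_ge0.
  rewrite (reindex_esum ([set: plane_tree] `*``
      (fun=> [set: seq plane_tree] `*`` (fun s => [set i | (i <= size s)%N]))) _
    (fun k => (take k.2.2 k.2.1 ++ k.1 :: drop k.2.2 k.2.1, k.2.2))).
    apply: eq_esum => -[c [s i]] [_ [_ /= si]]; rewrite /psi.
    have szi : size (take i s) = i by rewrite size_takel.
    rewrite nth_cat_mid// take_size_cat// drop_cat szi ltnNge leqnSn /=.
    rewrite subSnn /= drop0 cat_take_drop.
    have -> : forest_weight (take i s ++ c :: drop i s) =
        (weight c * forest_weight s * (size s).+1%:R^-1)%R.
      rewrite /forest_weight size_cat /= addnS -size_cat cat_take_drop.
      rewrite big_cat big_cons /= mulrCA -big_cat cat_take_drop factS natrM.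
      by rewrite invfM; ring.
    by rewrite !EFinM -!muleA; congr (_ * (_ * (_ * _))); exact: muleC.
  split => /=.
  - move=> [c [s i]] /= [_ [_ si]]; split => //=.
    by rewrite size_cat /= addnS -size_cat cat_take_drop ltnS.
  - move=> [c [s i]] [c' [s' i']]; rewrite !inE /= => -[_ [_ si]] [_ [_ si']].
    move=> [+ ii']; rewrite -{}ii' in si' *.
    move=> /eqP; rewrite eqseq_cat ?size_takel//= eqseq_cons.
    move=> /and3P[/eqP tt' /eqP -> /eqP dd'].
    by rewrite -(cat_take_drop i s) -(cat_take_drop i s') tt' dd'.
  - move=> [s i] /= [_ si]; exists (nth leaf s i, (take i s ++ drop i.+1 s, i)).
      split => //; split => //=.
      by rewrite size_cat size_takel ?leq_addr// ltnW.
    rewrite take_size_cat ?size_takel// 1?ltnW//.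
    rewrite drop_size_cat ?size_takel// 1?ltnW//.
    by rewrite -drop_nth// cat_take_drop.
apply: eq_esum => c _; rewrite -esumZl//; last first.
  by move=> s; rewrite mule_ge0// lee_fin.
apply: eq_esum => s _; rewrite esum_mkcond.
set v := _ * _ * _.
have v0 : 0 <= v by rewrite !mule_ge0// lee_fin// invr_ge0.
rewrite (@esum_fin_supp _ _ _ (iota 0 (size s).+1)) ?iota_uniq//.
- rewrite big_seq (eq_bigr (fun=> v * 1%:E)); last first.
    by move=> i; rewrite mem_iota mule1 => /= si; rewrite mem_set.
  rewrite -big_seq -ge0_sume_distrr// sumEFin.
  rewrite big_const_seq count_predT size_iota iter_addr_0 /v.
  by rewrite -muleA -EFinM mulVf// mule1.
- by move=> i; case: ifP.
- by move=> i; rewrite mem_iota => /= si; rewrite memNset//; apply/negP.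
Qed.

End Weight.

Section Balance.
Variables (R : realType) (rho : R).
Hypothesis rho_gt0 : 0 < rho.
Local Notation weight := (weight rho).
Local Notation forest_weight := (forest_weight rho).
Local Open Scope ereal_scope.

Let w0 t : (0 <= weight t)%R. Proof. exact: weight_ge0. Qed.
Let fw0 s : (0 <= forest_weight s)%R. Proof. exact: forest_weight_ge0. Qed.

Lemma esum_weight_PNode (f : plane_tree -> \bar R) : (forall t, 0 <= f t) ->
  \esum_(t in [set: plane_tree]) ((weight t)%:E * f t) =
  rho%:E * \esum_(s in [set: seq plane_tree])
    ((forest_weight s)%:E * f (PNode s)).
Proof.
move=> f0; rewrite esum_PNode -esumZl ?(ltW rho_gt0)//; last first.
  by move=> s; rewrite mule_ge0// lee_fin.
by apply: eq_esum => s _; rewrite weightE EFinM muleA.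
Qed.

(* In the second sum over the moves out of PNode s, the moved child is brought
   to the front of s: this is harmless because h is invariant. *)
Lemma plane_balance_bounded n (h : plane_tree -> plane_tree -> \bar R) :
  (forall t u, 0 <= h t u) ->
  (forall t t' u u', tree_iso t t' -> tree_iso u u' -> h t u = h t' u') ->
  (forall t u, (n < plane_volume t)%N -> h t u = 0) ->
  rho%:E * (\esum_(t in [set: plane_tree])
    ((weight t)%:E * \sum_(u <- adjunctions t) h t u)) =
  \esum_(t in [set: plane_tree])
    ((weight t)%:E * \sum_(u <- deletions t) h u t).
Proof.
(* Both sides sum over all trees, so the induction runs on the volume cutoff [n]: a child has
   smaller volume than its tree, and [h] with the other children frozen is a function of the same
   kind. *)
elim: n h => [|n IH] h h0 hI hn.
  have h_eq0 t u : h t u = 0 by exact/hn/plane_volume_gt0.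
  by rewrite !esum1 ?mule0// => t _; rewrite big1 ?mule0.
have hl s u : tree_iso (PNode s) u -> forall t, h t (PNode s) = h t u.
  by move=> su t; apply: hI => //; exact: tree_iso_refl.
have hr s u : tree_iso (PNode s) u -> forall t, h (PNode s) t = h u t.
  by move=> su t; apply: hI => //; exact: tree_iso_refl.
have iso_hd c c' s : tree_iso c c' ->
    tree_iso (PNode (c :: s)) (PNode (c' :: s)).
  by move=> cc'; apply: tree_iso_cons => //; exact: tree_iso_refl.
have s0 (I : Type) (r : seq I) (f : I -> \bar R) : (forall i, 0 <= f i) ->
    0 <= \sum_(i <- r) f i by move=> f0; apply: sume_ge0.
have eq_adj s : \sum_(u <- adjunctions (PNode s)) h (PNode s) u =
    h (PNode s) (PNode (leaf :: s)) + \sum_(x <- picks s)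
    \sum_(b <- adjunctions x.1) h (PNode (x.1 :: x.2)) (PNode (b :: x.2)).
  rewrite (big_adjunctions _ (F := h (PNode s))); last first.
    by move=> t u tu; apply: hI => //; exact: tree_iso_refl.
  congr (_ + _); rewrite big_seq [RHS]big_seq; apply: eq_bigr => x sx.
  by apply: eq_bigr => b _; apply: hr; apply: tree_iso_perm; exact: perm_picks.
have eq_del s : \sum_(u <- deletions (PNode s)) h u (PNode s) =
    \sum_(x <- picks s)
      (if x.1 == leaf then h (PNode x.2) (PNode (leaf :: x.2)) else 0) +
    \sum_(x <- picks s)
      \sum_(b <- deletions x.1) h (PNode (b :: x.2)) (PNode (x.1 :: x.2)).
  rewrite (big_deletions _ (F := h^~ (PNode s))); last first.
    by move=> t u tu; apply: hI => //; exact: tree_iso_refl.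
  congr (_ + _).
    rewrite big_mkcond big_seq [RHS]big_seq; apply: eq_bigr => x sx.
    case: eqP => // xl; apply: hl; apply: tree_iso_perm.
    by rewrite -xl; exact: perm_picks.
  rewrite big_seq [RHS]big_seq; apply: eq_bigr => x sx.
  by apply: eq_bigr => b _; apply: hl; apply: tree_iso_perm; exact: perm_picks.
rewrite !esum_weight_PNode; [|by move=> t; apply: s0..].
pose adj c s := \sum_(b <- adjunctions c) h (PNode (c :: s)) (PNode (b :: s)).
pose del c s := \sum_(b <- deletions c) h (PNode (b :: s)) (PNode (c :: s)).
pose lf c s : \bar R :=
  if c == leaf then h (PNode s) (PNode (leaf :: s)) else 0.
have adj0 c s : 0 <= adj c s by apply: s0.
have del0 c s : 0 <= del c s by apply: s0.
have lf0 c s : 0 <= lf c s by rewrite /lf; case: ifP.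
have fw_ge0 s (x : \bar R) : 0 <= x -> 0 <= (forest_weight s)%:E * x.
  by move=> x0; rewrite mule_ge0// lee_fin.
have w_ge0 s (x : \bar R) : 0 <= x -> 0 <= (weight s)%:E * x.
  by move=> x0; rewrite mule_ge0// lee_fin.
(* Leaf children of the root: in [esum_picks] only [c = leaf] counts, with weight rho, and this is
   the factor that compensates the birth of a leaf at the root. *)
have sum_leaf : \esum_(s in [set: seq plane_tree])
      ((forest_weight s)%:E * \sum_(x <- picks s) lf x.1 x.2) =
    rho%:E * \esum_(s in [set: seq plane_tree])
      ((forest_weight s)%:E * h (PNode s) (PNode (leaf :: s))).
  rewrite esum_picks// (@esum_unique _ _ _ leaf); first last.
  - move=> c cl; rewrite esum1 ?mule0// => s _.
    by rewrite /lf (negbTE cl) mule0.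
  - by move=> c; apply: w_ge0; apply: esum_ge0 => s _; exact: fw_ge0.
  by rewrite weight_leaf; congr (_ * _); apply: eq_esum => s _;
    rewrite /lf eqxx.
(* Moves inside a child: [esum_picks] decouples the child [c] from the other children [s], and the
   induction hypothesis applies in [c] for each fixed [s]. *)
have sum_move : rho%:E * (\esum_(s in [set: seq plane_tree])
      ((forest_weight s)%:E * \sum_(x <- picks s) adj x.1 x.2)) =
    \esum_(s in [set: seq plane_tree])
      ((forest_weight s)%:E * \sum_(x <- picks s) del x.1 x.2).
  have swap (f : plane_tree -> seq plane_tree -> \bar R) :
      (forall c s, 0 <= f c s) ->
      \esum_(c in [set: plane_tree]) ((weight c)%:E *
        \esum_(s in [set: seq plane_tree]) ((forest_weight s)%:E * f c s)) =
      \esum_(s in [set: seq plane_tree]) ((forest_weight s)%:E *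
        \esum_(c in [set: plane_tree]) ((weight c)%:E * f c s)).
    move=> f0; transitivity (\esum_(c in [set: plane_tree])
        \esum_(s in [set: seq plane_tree])
        ((weight c)%:E * ((forest_weight s)%:E * f c s))).
      by apply: eq_esum => c _; rewrite esumZl// => s; exact: fw_ge0.
    rewrite esum_exchange; last by move=> c s; apply/w_ge0/fw_ge0.
    apply: eq_esum => s _; rewrite -esumZl//; last by move=> c; exact: w_ge0.
    by apply: eq_esum => c _; rewrite muleCA.
  rewrite !esum_picks// !swap// -esumZl ?(ltW rho_gt0)//; last first.
    by move=> s; apply: fw_ge0; apply: esum_ge0 => c _; exact: w_ge0.
  apply: eq_esum => s _; rewrite muleCA; congr (_ * _).
  apply: (IH (fun c b => h (PNode (c :: s)) (PNode (b :: s)))) => //.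
    by move=> t t' u u' tt' uu'; apply: hI; exact: iso_hd.
  move=> t u nt; apply: hn => /=; rewrite ltnS.
  exact: leq_trans nt (leq_addr _ _).
congr (_ * _).
transitivity (\esum_(s in [set: seq plane_tree]) (
   (forest_weight s)%:E * \sum_(x <- picks s) lf x.1 x.2 +
   (forest_weight s)%:E * \sum_(x <- picks s) del x.1 x.2)).
  rewrite esumD; [|by move=> s _; apply/fw_ge0/s0..].
  rewrite sum_leaf -sum_move -ge0_muleDr; first last.
  - by apply: esum_ge0 => s _; apply/fw_ge0/s0.
  - by apply: esum_ge0 => s _; apply/fw_ge0.
  congr (_ * _); rewrite -esumD; first last.
  - by move=> s _; apply/fw_ge0/s0.
  - by move=> s _; apply/fw_ge0.
  apply: eq_esum => s _; rewrite eq_adj ge0_muleDr//.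
  by apply: s0 => x; exact: adj0.
apply: eq_esum => s _; rewrite eq_del ge0_muleDr//.
  by apply: s0 => x; exact: lf0.
by apply: s0 => x; exact: del0.
Qed.

Definition tree_weight (T : tree) : \bar R :=
  \esum_(t in [set t | \pi_tree t = T]) (weight t)%:E.

Lemma eq_pi_tree t u : (\pi_tree t = \pi_tree u) <-> tree_iso t u.
Proof. by split => [/eqP|?]; [rewrite piE|apply/eqP; rewrite piE]. Qed.

Definition nb_adjunctions (S T : tree) : nat :=
  count (fun u => \pi_tree u == T) (adjunctions (repr S)).

Definition nb_deletions (S T : tree) : nat :=
  count (fun u => \pi_tree u == T) (deletions (repr S)).

Lemma sum_indicator (A : Type) (a : pred A) (s : seq A) :
  \sum_(u <- s) ((a u)%:R : R)%:E = (count a s)%:R%:E.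
Proof.
rewrite sumEFin; congr _%:E.
rewrite -natr_sum; congr _%:R; elim: s => [|u s IH]; first by rewrite big_nil.
by rewrite big_cons IH.
Qed.

(** The plane balance for the indicator that [t] represents [S] and [u] represents [T]. It vanishes
    when the volume of [t] exceeds that of [S], which supplies the cutoff. *)
Lemma tree_balance (S T : tree) :
  rho%:E * tree_weight S * (nb_adjunctions S T)%:R%:E =
  tree_weight T * (nb_deletions T S)%:R%:E.
Proof.
pose h t u : \bar R := ((\pi_tree t == S) && (\pi_tree u == T))%:R%:E.
have hI t t' u u' : tree_iso t t' -> tree_iso u u' -> h t u = h t' u'.
  by move=> /eq_pi_tree tt' /eq_pi_tree uu'; rewrite /h tt' uu'.
have isoE t (U : tree) : \pi_tree t = U -> tree_iso t (repr U).
  by move=> tU; apply/eq_pi_tree; rewrite reprK.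
have := @plane_balance_bounded (volume S) h.
have -> : \esum_(t in [set: plane_tree])
    ((weight t)%:E * \sum_(u <- adjunctions t) h t u) =
    tree_weight S * (nb_adjunctions S T)%:R%:E.
  rewrite -esumZr//.
  rewrite [RHS]esum_mkcond; apply: eq_esum => t _.
  have [tS|tS] := pselect (\pi_tree t = S); last first.
    rewrite memNset//= big1 ?mule0// => u _; rewrite /h.
    by have /eqP/negbTE -> := tS.
  rewrite mem_set//; congr (_ * _).
  rewrite (big_adjunctions_iso _ _ (isoE _ _ tS)); last first.
    by move=> u v; apply: hI; exact: tree_iso_refl.
  rewrite /nb_adjunctions -sum_indicator; apply: eq_bigr => u _.
  by rewrite /h tS eqxx.
have -> : \esum_(t in [set: plane_tree])
    ((weight t)%:E * \sum_(u <- deletions t) h u t) =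
    tree_weight T * (nb_deletions T S)%:R%:E.
  rewrite -esumZr//.
  rewrite [RHS]esum_mkcond; apply: eq_esum => t _.
  have [tT|tT] := pselect (\pi_tree t = T); last first.
    rewrite memNset//= big1 ?mule0// => u _; rewrite /h.
    by have /eqP/negbTE -> := tT; rewrite andbF.
  rewrite mem_set//; congr (_ * _).
  rewrite (big_deletions_iso _ (F := h^~ t) _ (isoE _ _ tT)); last first.
    by move=> u v uv; apply: hI uv _; exact: tree_iso_refl.
  rewrite /nb_deletions -sum_indicator; apply: eq_bigr => u _.
  by rewrite /h tT eqxx andbT.
rewrite muleA; apply => //.
  by move=> t u; rewrite lee_fin.
move=> t u; rewrite /h; case: eqP => //= /isoE /plane_volume_iso ->.
by rewrite ltnn.
Qed.

End Balance.

(** * Total mass, mean and coefficients *)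

Lemma big_picks_fst (V : Type) (idx : V) (op : Monoid.com_law idx)
    (A : eqType) (f : A -> V) (s : seq A) :
  \big[op/idx]_(x <- picks s) f x.1 = \big[op/idx]_(c <- s) f c.
Proof.
elim: s => [|c s IH]; first by rewrite !big_nil.
by rewrite /= !big_cons big_map -IH.
Qed.

Lemma plane_volume_le_sum c s : c \in s ->
  (plane_volume c <= sumn (map plane_volume s))%N.
Proof.
elim: s => //= b s IH; rewrite inE => /predU1P[->|/IH]; first exact: leq_addr.
by move=> /leq_trans; apply; exact: leq_addl.
Qed.

Section Mass.
Variables (R : realType) (rho r : R).
Hypothesis rho_gt0 : 0 < rho.
Hypothesis rE : r * expR (- r) = rho.
Hypothesis r_min : forall s, s * expR (- s) = rho -> r <= s.
Hypothesis r_le1 : r <= 1.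
Local Notation weight := (weight rho).
Local Notation forest_weight := (forest_weight rho).
Local Open Scope ereal_scope.

Let w0 t : (0 <= weight t)%R. Proof. exact: weight_ge0. Qed.
Let fw0 s : (0 <= forest_weight s)%R. Proof. exact: forest_weight_ge0. Qed.

Lemma root_gt0 : (0 < r)%R.
Proof. by rewrite -(pmulr_lgt0 _ (expR_gt0 (- r))) rE. Qed.

Lemma root_exp : (rho * expR r = r)%R.
Proof. by rewrite -rE -mulrA -expRD addNr expR0 mulr1. Qed.

(** If A_k is the mass of volumes at most k, the children of the root give A_(k+1) <= rho exp A_k <=
    rho exp r = r. Finiteness of the mass and its upper bound come together. *)
Lemma esum_weight_le : \esum_(t in [set: plane_tree]) (weight t)%:E <= r%:E.
Proof.
apply: (esum_le_filtration (v := plane_volume)) => [t|k].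
  by rewrite lee_fin.
elim: k => [|k IH].
  rewrite (_ : [set x | _] = set0) ?esum_set0 ?lee_fin ?(ltW root_gt0)//.
  by apply/seteqP; split => t //=; rewrite leqNgt plane_volume_gt0.
pose q t := if (plane_volume t <= k)%N then weight t else 0%R.
have q0 t : (0 <= q t)%R by rewrite /q; case: ifP.
have qE : \esum_(t in [set: plane_tree]) (q t)%:E =
    \esum_(t in [set t | (plane_volume t <= k)%N]) (weight t)%:E.
  rewrite [RHS]esum_mkcond; apply: eq_esum => t _; rewrite /q.
  by case: ifPn => tk; [rewrite mem_set|rewrite memNset//; exact/negP].
have [a aE] : exists a, \esum_(t in [set: plane_tree]) (q t)%:E = a%:E.
  exists (fine (\esum_(t in [set: plane_tree]) (q t)%:E)); rewrite fineK//.
  rewrite ge0_fin_numE ?esum_ge0// => [|t _]; last by rewrite lee_fin.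
  by rewrite qE (le_lt_trans IH)// ltry.
have ar : (a <= r)%R by rewrite -lee_fin -aE qE.
apply: (@le_trans _ _ (rho%:E * (expR a)%:E)); last first.
  by rewrite -EFinM lee_fin -[leRHS]root_exp ler_pM2l// ler_expR.
rewrite -(esum_prod_exp q0 aE) esum_mkcond esum_PNode -esumZl ?(ltW rho_gt0)//.
  apply: le_esum => s _; rewrite weightE.
  have p0 : (0 <= \prod_(c <- s) q c)%R by apply: prodr_ge0.
  case: ifPn => [|_]; last first.
    by rewrite lee_fin mulr_ge0 ?(ltW rho_gt0)// divr_ge0.
  rewrite inE => /= sk; rewrite lee_fin ler_pM2l// ler_pM2r ?invr_gt0//.
  rewrite le_eqVlt; apply/orP; left; apply/eqP; rewrite big_seq [RHS]big_seq.
  apply: eq_bigr => c cs; rewrite /q (leq_trans (plane_volume_le_sum cs))//.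
by move=> s; rewrite lee_fin divr_ge0// prodr_ge0.
Qed.

(** The fixed point equation would also allow the larger root; [esum_weight_le] excludes it, and
    [r_min] gives the other inequality. *)
Lemma esum_weight : \esum_(t in [set: plane_tree]) (weight t)%:E = r%:E.
Proof.
have [a aE] : exists a, \esum_(t in [set: plane_tree]) (weight t)%:E = a%:E.
  exists (fine (\esum_(t in [set: plane_tree]) (weight t)%:E)); rewrite fineK//.
  rewrite ge0_fin_numE ?esum_ge0// => [|t _]; last by rewrite lee_fin.
  by rewrite (le_lt_trans esum_weight_le)// ltry.
have aE' : (a = rho * expR a)%R.
  apply: EFin_inj; rewrite -[LHS]aE EFinM -(esum_prod_exp w0 aE) esum_PNode.
  rewrite -esumZl ?(ltW rho_gt0)//.
  by apply: eq_esum => s _; rewrite weightE EFinM.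
rewrite aE; congr _%:E; apply/eqP; rewrite eq_le -lee_fin -aE esum_weight_le.
by apply: r_min; rewrite {1}aE' -mulrA -expRD subrr expR0 mulr1.
Qed.

Lemma esum_forest_weight :
  \esum_(s in [set: seq plane_tree]) (forest_weight s)%:E = (expR r)%:E.
Proof. exact: esum_prod_exp esum_weight. Qed.

(** Once a child is marked, the remaining forest contributes exp r independently of it, and rho exp
    r = r. *)
Lemma esum_picks_fst (f : plane_tree -> R) : (forall t, 0 <= f t)%R ->
  rho%:E * (\esum_(s in [set: seq plane_tree])
    ((forest_weight s)%:E * \sum_(x <- picks s) (f x.1)%:E)) =
  r%:E * \esum_(t in [set: plane_tree]) ((weight t)%:E * (f t)%:E).
Proof.
move=> f0.
rewrite (esum_picks rho_gt0 (phi := fun c _ => (f c)%:E)); last first.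
  by move=> c _; rewrite lee_fin.
rewrite -esumZl ?(ltW rho_gt0)//; last first.
  move=> c; rewrite mule_ge0 ?lee_fin// esum_ge0// => s _.
  by rewrite mule_ge0 ?lee_fin.
rewrite -esumZl ?(ltW root_gt0)//; last by move=> c; rewrite mule_ge0 ?lee_fin.
apply: eq_esum => c _; rewrite esumZr//.
rewrite esum_forest_weight -[in RHS]root_exp -!EFinM; congr _%:E; ring.
Qed.

Lemma volume_PNode s :
  (plane_volume (PNode s))%:R%:E =
  1 + \sum_(x <- picks s) (plane_volume x.1)%:R%:E :> \bar R.
Proof.
rewrite (big_picks_fst _ (fun c => (plane_volume c)%:R%:E)) sumEFin -natr_sum.
by rewrite -EFinD -natr1 addrC /=; congr (_ + _%:R)%:E; rewrite sumnE big_map.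
Qed.

(** The mean solves M = r + r M in the extended reals. For r = 1 no finite M does. For r < 1 the
    value +oo still does, so finiteness has to be proved apart. *)
Lemma esum_weight_volume :
  \esum_(t in [set: plane_tree]) ((weight t)%:E * (plane_volume t)%:R%:E) =
  if (r == 1)%R then +oo else (r / (1 - r))%:E.
Proof.
have fw_ge0 s (x : \bar R) : 0 <= x -> 0 <= (forest_weight s)%:E * x.
  by move=> x0; rewrite mule_ge0// lee_fin fw0.
have w_ge0 t n : 0 <= (weight t)%:E * n%:R%:E.
  by rewrite mule_ge0// lee_fin.
pose M := \esum_(t in [set: plane_tree])
  ((weight t)%:E * (plane_volume t)%:R%:E).
have M0 : 0 <= M by rewrite esum_ge0.
have s0 (f : plane_tree -> nat) s :
    0 <= \sum_(x <- picks s) (f x.1)%:R%:E :> \bar R.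
  by rewrite sumEFin lee_fin sumr_ge0.
have expand (f : plane_tree -> nat) :
    rho%:E * (\esum_(s in [set: seq plane_tree])
    ((forest_weight s)%:E * (1 + \sum_(x <- picks s) (f x.1)%:R%:E))) =
    r%:E + r%:E * \esum_(t in [set: plane_tree]) ((weight t)%:E * (f t)%:R%:E).
  rewrite -esum_picks_fst//.
  rewrite (_ : r%:E = rho%:E * \esum_(s in [set: seq plane_tree])
      (forest_weight s)%:E); last first.
    by rewrite esum_forest_weight -EFinM root_exp.
  rewrite -ge0_muleDr; first last.
  - by apply: esum_ge0 => s _; exact/fw_ge0/s0.
  - by apply: esum_ge0 => s _; rewrite lee_fin fw0.
  rewrite -esumD; first last.
  - by move=> s _; exact/fw_ge0/s0.
  - by move=> s _; rewrite lee_fin fw0.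
  congr (_ * _); apply: eq_esum => s _.
  by rewrite ge0_muleDr ?mule1//; exact: s0.
have ME : M = r%:E + r%:E * M.
  rewrite -expand /M esum_weight_PNode//; congr (_ * _).
  by apply: eq_esum => s _; rewrite volume_PNode.
rewrite -/M; case: eqP => [r1|/eqP r1].
  have [/fineK Mf|] := boolP (M \is a fin_num); last first.
    by rewrite ge0_fin_numE// -leNgt leye_eq => /eqP.
  have := ME; rewrite -Mf r1 mul1e -EFinD => -[] /eqP.
  by rewrite eq_sym -subr_eq0 addrK oner_eq0.
have r_lt1 : (r < 1)%R by rewrite lt_neqAle r1.
(* The means truncated at volume k satisfy M_(k+1) <= r + r M_k, and r / (1 - r) is the fixed point
   of this recursion. *)
have Mle : M <= (r / (1 - r))%:E.
  apply: (esum_le_filtration (v := plane_volume)) => // k.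
  elim: k => [|k IH].
    rewrite (_ : [set x | _] = set0) ?esum_set0.
      by rewrite lee_fin divr_ge0 ?subr_ge0 ?(ltW root_gt0)// ltW.
    by apply/seteqP; split => t //=; rewrite leqNgt plane_volume_gt0.
  pose f t := if (plane_volume t <= k)%N then plane_volume t else 0%N.
  apply: (@le_trans _ _ (r%:E +
      r%:E * \esum_(t in [set: plane_tree]) ((weight t)%:E * (f t)%:R%:E))).
    rewrite -expand esum_mkcond.
    rewrite (eq_esum (b := fun t => (weight t)%:E *
        (if (plane_volume t <= k.+1)%N then plane_volume t else 0%N)%:R%:E)).
      rewrite esum_weight_PNode//; last by move=> t; rewrite lee_fin.
      apply: lee_pmul => //.
      - by rewrite lee_fin ltW.
      - by apply: esum_ge0 => s _; apply: fw_ge0; rewrite lee_fin.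
      apply: le_esum => s _; apply: lee_pmul => //; rewrite ?lee_fin//.
      case: ifPn => [|_]; last by rewrite adde_ge0//; exact: s0.
      rewrite ltnS => sk; rewrite volume_PNode leeD2l// !sumEFin lee_fin.
      rewrite (big_picks_fst _ (fun c => (plane_volume c)%:R)).
      rewrite (big_picks_fst _ (fun c => (f c)%:R)) big_seq [leRHS]big_seq.
      apply: ler_sum => c cs; rewrite /f.
      by rewrite (leq_trans _ sk)// plane_volume_le_sum.
    move=> t _; case: ifPn => [/set_mem /= ->//|/negP]; rewrite inE.
    by move=> /negP/negbTE ->; rewrite mule0.
  apply: (@le_trans _ _ (r%:E + r%:E * (r / (1 - r))%:E)).
    rewrite leeD2l// lee_pmul//.
    - by rewrite lee_fin ltW// root_gt0.
    - by apply: esum_ge0.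
    apply: le_trans IH; rewrite [leRHS]esum_mkcond; apply: le_esum => t _.
    rewrite /f; case: ifPn => tk; first by rewrite mem_set.
    by rewrite memNset ?mule0//; exact/negP.
  rewrite -EFinM -EFinD lee_fin le_eqVlt; apply/orP; left; apply/eqP.
  by field; rewrite subr_eq0 eq_sym.
have /fineK Mf : M \is a fin_num.
  by rewrite ge0_fin_numE// (le_lt_trans Mle)// ltry.
move: ME; rewrite -Mf -EFinM -EFinD => -[] ME; congr _%:E.
have r1' : (1 - r != 0)%R by rewrite subr_eq0 eq_sym.
by apply: (mulIf r1'); rewrite divfK// mulrBr mulr1 {1}ME; ring.
Qed.

End Mass.

(** * Mass of the forests with given volume and number of trees *)

Section Coefficients.
Variable R : realType.

(* The coefficient of z^N in exp (m A(z)), or of z^(N + m) in A(z)^m, where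
   A(z) = z exp A(z). *)
Definition forest_coef (N m : nat) : R :=
  if N is N'.+1 then m%:R * (N + m)%:R ^+ N' / N`!%:R else 1.

(* Removing the root of the first of m + 1 trees leaves m + d trees, where d is
   the number of children of that root. *)
Lemma forest_coefS N m : forest_coef N m.+1 =
  \sum_(d < N.+1) forest_coef (N - d) (m + d) / d`!%:R.
Proof.
case: N => [|N].
  by rewrite big_ord_recl big_ord0 /= fact0 divr1 addr0.
(* (N.+1 - d) + (m + d) does not depend on d, so all terms are powers of [x]. After multiplication
   by [x] and by N.+1 factorial the term d is (m + d) x^(N.+1 - d) times a binomial coefficient, d =
   N.+1 included. *)
pose x : R := (N.+1 + m)%:R.
have x0 : x != 0 by rewrite pnatr_eq0 addSn.
apply: (mulfI x0).
have fN0 (n : nat) : n`!%:R != 0 :> R by rewrite pnatr_eq0 -lt0n fact_gt0.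
apply: (mulfI (fN0 N.+1)).
have termE (d : 'I_N.+2) :
    N.+1`!%:R * (x * (forest_coef (N.+1 - d) (m + d) / d`!%:R)) =
    m%:R * (x ^+ (N.+1 - d) * 1 ^+ d *+ 'C(N.+1, d)) +
    d%:R * (x ^+ (N.+1 - d) *+ 'C(N.+1, d)).
  have dN : (d <= N.+1)%N by rewrite -ltnS.
  rewrite expr1n mulr1 -mulrDl -natrD -[_ *+ 'C(_, _)]mulr_natr.
  have binE : ('C(N.+1, d))%:R =
      N.+1`!%:R / (d`!%:R * (N.+1 - d)`!%:R) :> R.
    by rewrite -(bin_fact dN) !natrM mulfK// mulf_neq0.
  case E : (N.+1 - d)%N => [|k] /=.
    have dE : (d : nat) = N.+1 by apply/eqP; rewrite eqn_leq dN -subn_eq0 E.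
    rewrite binE E dE fact0 /x; field.
    exact: fN0.
  have -> : (k.+1 + (m + d))%:R = x.
    by rewrite /x -E addnC addnAC -addnA subnK// addnC.
  by rewrite binE E exprS; field; rewrite !fN0.
rewrite !mulr_sumr (eq_bigr _ (fun d _ => termE d)) big_split /=.
rewrite -mulr_sumr -exprDn.
have -> : \sum_(d < N.+2) d%:R * (x ^+ (N.+1 - d) *+ 'C(N.+1, d)) =
    N.+1%:R * (x + 1) ^+ N.
  rewrite big_ord_recl mul0r add0r exprDn mulr_sumr; apply: eq_bigr => d _.
  rewrite /= [bump 0 d](_ : _ = d.+1)// subSS expr1n mulr1.
  rewrite -[_ *+ 'C(N.+1, _)]mulr_natr.
  rewrite -[_ *+ 'C(N, _)]mulr_natr [LHS]mulrCA [RHS]mulrCA; congr (_ * _).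
  by rewrite -!natrM -mul_bin_diag.
have -> : (N.+1 + m.+1)%:R = x + 1 by rewrite addnS -natr1.
have mE : m%:R = x - N.+1%:R by rewrite /x natrD addrC addKr.
by rewrite exprS -natr1 mE; field; rewrite fN0.
Qed.

Variable rho : R.
Hypothesis rho_gt0 : 0 < rho.
Local Notation weight := (weight rho).
Local Notation forest_weight := (forest_weight rho).
Local Open Scope ereal_scope.

Lemma size_forest_volume s : (size s <= forest_volume s)%N.
Proof.
rewrite /forest_volume; elim: s => //= c s IH; rewrite -add1n leq_add//.
exact: plane_volume_gt0.
Qed.

Lemma esum_forest N m :
  \esum_(s in [set: seq plane_tree])
    (if (size s == m) && (forest_volume s == N + m)%N
     then \prod_(c <- s) weight c else 0%R)%:E =
  (rho ^+ (N + m) * forest_coef N m)%:E.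
Proof.
have p0 s : (0 <= \prod_(c <- s) weight c)%R by exact: prod_weight_ge0.
have if0 (b : bool) (x : R) : (0 <= x)%R ->
    0 <= (if b then x else 0%R)%:E by case: b; rewrite lee_fin.
(* Lexicographic induction on [N], then [m]: removing the first root leads from (N, m + 1) to (N -
   d, m + d), where [m] has dropped if d = 0 and [N] has dropped otherwise. *)
have [n Nn] := ubnP N; elim: n N m Nn => // n IHn N.
elim=> [|m IHm] Nn.
  rewrite (@esum_unique _ _ _ [::]) => [|s|[|c s]]//=; last exact: if0.
  rewrite big_nil addn0; case: N {Nn} => [|N] /=; first by rewrite mulr1.
  by rewrite !mul0r mulr0.
rewrite esum_cons => [|s]; last exact: if0.
rewrite /= add0e.
(* [w] lists the children of the removed root followed by the [m] other trees, so that root had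
   [size w - m] children: hence the factorial. *)
pose g w : \bar R := (if (forest_volume w == N + m)%N then
  rho * (\prod_(c <- w) weight c) / (size w - m)`!%:R else 0)%:E.
transitivity (\esum_(w in [set w | (m <= size w)%N]) g w).
  have g0 s1 s2 : 0 <= g (s1 ++ s2).
    by apply: if0; rewrite divr_ge0// mulr_ge0// ltW.
  transitivity (\esum_(s1 in [set: seq plane_tree])
      \esum_(s2 in [set s2 | size s2 = m]) g (s1 ++ s2)).
    rewrite esum_PNode; apply: eq_esum => s1 _; rewrite [RHS]esum_mkcond.
    apply: eq_esum => s2 _; rewrite eqSS.
    have -> : (forest_volume (PNode s1 :: s2) == N + m.+1)%N =
        (forest_volume (s1 ++ s2) == N + m)%N.
      by rewrite /forest_volume /= map_cat sumn_cat addSn addnS eqSS.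
    have [sm|sm] := eqVneq (size s2) m; last first.
      by rewrite memNset//=; exact/eqP.
    rewrite mem_set//= /g; case: ifP => // _.
    rewrite size_cat sm addnK big_cons big_cat -/(weight (PNode s1)).
    by rewrite weightE /forest_weight; congr _%:E => /=; ring.
  rewrite (esum_cat m (g := fun s1 s2 => g (s1 ++ s2)))//.
  by apply: eq_esum => w _; rewrite cat_take_drop.
(* Sorting by the number d of children; d <= N because a forest has at least as many vertices as
   trees. *)
transitivity (\esum_(w in [set: seq plane_tree]) \sum_(d < N.+1)
    ((if (size w == m + d)%N && (forest_volume w == (N - d) + (m + d))%N
      then \prod_(c <- w) weight c else 0%R)%:E * (rho / d`!%:R)%:E)).
  rewrite esum_mkcond; apply: eq_esum => w _.
  have [wN|wN] := eqVneq (forest_volume w) (N + m)%N; last first.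
    rewrite big1; first by rewrite /g (negbTE wN); case: ifP.
    move=> d _; have -> : (N - d + (m + d) = N + m)%N.
      by have := ltn_ord d; lia.
    by rewrite (negbTE wN) andbF mul0e.
  have [mw|mw] := leqP m (size w); last first.
    rewrite memNset//=; last by apply/negP; rewrite -ltnNge.
    rewrite big1// => d _; case: eqP => [E|]; last by rewrite mul0e.
    by move: mw; rewrite E ltnNge leq_addr.
  rewrite mem_set// /g wN eqxx.
  have dN : (size w - m < N.+1)%N.
    by rewrite ltnS leq_subLR addnC -wN size_forest_volume.
  rewrite (bigD1 (Ordinal dN))//= [X in _ = _ + X]big1 => [|d dw].
    rewrite subnKC// eqxx /= ifT; last first.
      by apply/eqP; move: (size w) dN mw => k; lia.
    by rewrite adde0 -EFinM; congr _%:E; ring.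
  case: eqP => [E|]; last by rewrite mul0e.
  by case/eqP: dw; apply: val_inj; rewrite /= E addKn.
have rd0 d : (0 <= rho / d`!%:R)%R by rewrite divr_ge0// ltW.
rewrite esum_sum; last first.
  by move=> w d _ _; rewrite mule_ge0//; [exact: if0|rewrite lee_fin].
rewrite addnS exprS -mulrA forest_coefS mulr_sumr mulr_sumr -sumEFin.
apply: eq_bigr => d _; rewrite esumZr//; last by move=> w; exact: if0.
have [d0|d0] := posnP d.
  rewrite d0 subn0 addn0 IHm// -EFinM; congr _%:E.
  ring.
rewrite IHn; last by have := ltn_ord d; lia.
have -> : (N - d + (m + d) = N + m)%N by have := ltn_ord d; lia.
by rewrite -EFinM; congr _%:E; ring.
Qed.

(** A tree is a forest with one entry, and k^(k-2) / (k-1)! = k^(k-1) / k!. *)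
Lemma esum_weight_eq_volume k : (1 <= k)%N ->
  \esum_(t in [set t | plane_volume t = k]) (weight t)%:E =
  (k%:R ^+ k.-1 / k`!%:R * rho ^+ k)%:E.
Proof.
case: k => // k _; have := esum_forest k 1%N.
rewrite esum_cons; last first.
  by move=> s; case: ifP => _; rewrite lee_fin// prod_weight_ge0.
rewrite /= add0e => E; rewrite esum_mkcond.
transitivity ((rho ^+ (k + 1) * forest_coef k 1%N)%:E); last first.
  rewrite addn1; congr _%:E; case: k {E} => [|k] /=.
    by rewrite expr0 (_ : 1`! = 1)%N //; field.
  rewrite addn1 mul1r !factS !natrM [(k.+2%:R ^+ k.+1)%R]exprS.
  have k2 : (k.+2%:R != 0 :> R)%R by rewrite pnatr_eq0.
  have k1 : (k.+1%:R * k`!%:R != 0 :> R)%R.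
    by rewrite -natrM pnatr_eq0 muln_eq0 negb_or /= -lt0n fact_gt0.
  move: k2 k1; move: (k.+2%:R)%R (_ * k`!%:R)%R => x y x0 y0.
  by field; rewrite x0 y0.
rewrite -E; apply: eq_esum => t _.
rewrite (@esum_unique _ _ _ [::]) => [|s|[|c s]]//=; last first.
  by case: ifP => _; rewrite lee_fin// prod_weight_ge0.
rewrite /forest_volume big_seq1 /= addn0 addn1.
by have [tk|/eqP tk] := eqVneq; [rewrite mem_set|rewrite memNset].
Qed.

End Coefficients.

(** * The stationary measure on trees *)

Lemma volume_pi u : volume (\pi_tree u) = plane_volume u.
Proof. by apply: plane_volume_iso; apply/eq_pi_tree; rewrite reprK. Qed.

Lemma volume_gt0 T : (0 < volume T)%N.
Proof. exact: plane_volume_gt0. Qed.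

Lemma volume_le1 T : (volume T <= 1)%N -> T = root_tree.
Proof.
rewrite /volume -{2}[T]reprK; case: (repr T) => -[|c s] //=.
by rewrite ltnS leqNgt ltn_addr// plane_volume_gt0.
Qed.

Lemma count_pi_gt0 (l : seq plane_tree) T :
  (0 < count (fun u => \pi_tree u == T) l)%N = (T \in map \pi_tree l).
Proof.
rewrite -has_count; apply/hasP/mapP => -[u ul] => [/eqP<-|->]; exists u => //.
Qed.

Lemma sum_count_pi (l : seq plane_tree) (s : seq tree) : uniq s ->
  {subset map \pi_tree l <= s} ->
  (\sum_(T <- s) count (fun u => \pi_tree u == T) l)%N = size l.
Proof.
move=> us; elim: l => [|u l IH] ls; first by rewrite big1.
rewrite /= big_split /= IH => [|T Tl]; last by apply: ls; rewrite inE Tl orbT.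
rewrite -[RHS]add1n; congr (_ + _)%N.
rewrite (bigD1_seq (\pi_tree u)) ?ls ?mem_head//= eqxx big1// => T.
by rewrite eq_sym => /negbTE ->.
Qed.

(** Duplicates are dropped because [jump_rate] already counts multiplicities. *)
Definition moves (S : tree) : seq tree :=
  undup (map \pi_tree (adjunctions (repr S) ++ deletions (repr S))).

Lemma moves_uniq S : uniq (moves S). Proof. exact: undup_uniq. Qed.

Lemma volume_adjunctions S T :
  (0 < nb_adjunctions S T)%N -> volume T = (volume S).+1.
Proof.
rewrite /nb_adjunctions count_pi_gt0 => /mapP[u uS ->].
by rewrite volume_pi (plane_volume_adjunctions uS).
Qed.

Lemma volume_deletions S T :
  (0 < nb_deletions S T)%N -> (volume T).+1 = volume S.
Proof.
rewrite /nb_deletions count_pi_gt0 => /mapP[u uS ->].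
by rewrite volume_pi (plane_volume_deletions uS).
Qed.

Lemma exists_deletion S : (1 < volume S)%N ->
  exists2 T, (volume T).+1 = volume S & (0 < nb_deletions S T)%N.
Proof.
move=> /deletions_neq0; case E : deletions => [//|u l] _.
have uS : (0 < nb_deletions S (\pi_tree u))%N.
  by rewrite /nb_deletions count_pi_gt0 E mem_head.
by exists (\pi_tree u) => //; exact: volume_deletions.
Qed.

Section Rates.
Variables (R : realType) (lambda mu : R).
Hypotheses (lambda_gt0 : 0 < lambda) (mu_gt0 : 0 < mu).
Local Notation jump := (jump_rate lambda mu).
Local Notation rho := (lambda / mu).

Let rho_gt0 : 0 < rho. Proof. exact: divr_gt0. Qed.

Lemma jump_rateE S T : jump S T =
  lambda * (nb_adjunctions S T)%:R + mu * (nb_deletions S T)%:R.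
Proof. by []. Qed.

Lemma jump_rate_ge0 S T : 0 <= jump S T.
Proof. by rewrite addr_ge0// mulr_ge0// ltW. Qed.

Lemma jump_rate_moves S T : T \notin moves S -> jump S T = 0.
Proof.
rewrite mem_undup map_cat mem_cat negb_or -!count_pi_gt0 -!eqn0Ngt.
by move=> /andP[/eqP a0 /eqP d0]; rewrite /jump_rate a0 d0 !mulr0 addr0.
Qed.

Lemma moves_irr S : S \notin moves S.
Proof.
rewrite mem_undup map_cat mem_cat negb_or -!count_pi_gt0.
apply/andP; split; apply/negP.
  by move=> /(@volume_adjunctions S S)/eqP; rewrite ltn_eqF.
by move=> /(@volume_deletions S S)/eqP; rewrite gtn_eqF.
Qed.

Lemma jump_rate_diag S : jump S S = 0.
Proof. exact/jump_rate_moves/moves_irr. Qed.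

Lemma sum_jump_rate S :
  \sum_(T <- moves S) jump S T = exit_rate lambda mu S.
Proof.
rewrite big_split -!mulr_sumr -!natr_sum /=.
by rewrite !sum_count_pi ?moves_uniq// => T; rewrite mem_undup map_cat mem_cat;
  move=> ->; rewrite ?orbT.
Qed.

(** A move changes the volume by one, so the level [n] is crossed only from volume [n] and only by a
    birth, one at rate lambda for each vertex. *)
Lemma sum_jump_rate_gt S (n : nat) : (volume S <= n)%N ->
  \sum_(T <- moves S | (n < volume T)%N) jump S T <=
  if volume S == n then lambda * n%:R else 0.
Proof.
move=> Sn; case: eqP => [<-|/eqP Sn'].
  rewrite (@le_trans _ _ (\sum_(T <- moves S)
      lambda * (nb_adjunctions S T)%:R))//.
    rewrite big_mkcond; apply: ler_sum => T _; case: ifPn => ST; last first.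
      by rewrite mulr_ge0// ltW.
    rewrite jump_rateE -[leRHS]addr0 lerD2l.
    case: (posnP (nb_deletions S T)) => [->|/volume_deletions E].
      by rewrite mulr0.
    by move: ST; rewrite -E ltnNge leqnSn.
  rewrite -mulr_sumr -natr_sum sum_count_pi ?moves_uniq//.
    by rewrite size_adjunctions.
  by move=> T; rewrite mem_undup map_cat mem_cat => ->.
rewrite big1_seq// => T /andP[nT _]; rewrite jump_rateE.
case: (posnP (nb_adjunctions S T)) => [->|/volume_adjunctions E]; last first.
  by move: nT; rewrite E ltnS leqNgt ltn_neqAle Sn' Sn.
case: (posnP (nb_deletions S T)) => [->|/volume_deletions E].
  by rewrite !mulr0 addr0.
by move: nT; rewrite ltnNge (leq_trans _ Sn)// -E leqnSn.
Qed.

Lemma exists_jump S : (1 < volume S)%N ->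
  exists2 T, (volume T).+1 = volume S & 0 < jump S T.
Proof.
move=> /exists_deletion[T TS dT]; exists T => //; rewrite jump_rateE.
by rewrite ltr_wpDl ?mulr_ge0 ?mulr_gt0 ?ltr0n// ltW.
Qed.

Variable r : R.
Hypothesis rE : r * expR (- r) = rho.
Hypothesis r_min : forall s, s * expR (- s) = rho -> r <= s.
Hypothesis r_le1 : r <= 1.
Let r_gt0 : 0 < r. Proof. exact: root_gt0 rE. Qed.
Let w0 t : 0 <= weight rho t. Proof. exact: weight_ge0. Qed.

Definition stationary (T : tree) : R := fine (tree_weight rho T) / r.
Local Notation pi := stationary.

Lemma tree_weightE T : tree_weight rho T = (r * pi T)%:E.
Proof.
rewrite /stationary (mulrC r) divfK ?gt_eqF// fineK// ge0_fin_numE.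
  apply: (@le_lt_trans _ _ r%:E); last exact: ltry.
  rewrite -(esum_weight rho_gt0 rE r_min) /tree_weight esum_mkcond.
  by apply: le_esum => t _; case: ifP => // _; rewrite lee_fin.
by apply: esum_ge0 => t _; rewrite lee_fin.
Qed.

Lemma stationary_gt0 T : 0 < pi T.
Proof.
have : (0 < tree_weight rho T)%E.
  apply: (@lt_le_trans _ _ (weight rho (repr T))%:E).
    by rewrite lte_fin weight_gt0.
  rewrite /tree_weight esum_mkcond.
  apply: le_trans (esum_term_le (repr T) _); last first.
    by move=> t; case: ifP => // _; rewrite lee_fin.
  by rewrite mem_set//=; exact: reprK.
by rewrite tree_weightE lte_fin pmulr_rgt0.
Qed.

Lemma stationary_ge0 T : 0 <= pi T. Proof. exact/ltW/stationary_gt0. Qed.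

Lemma stationary_balance S T : pi S * jump S T = pi T * jump T S.
Proof.
have bal U V : pi U * (lambda * (nb_adjunctions U V)%:R) =
    pi V * (mu * (nb_deletions V U)%:R).
  have := tree_balance rho_gt0 U V; rewrite !tree_weightE -!EFinM => -[] E.
  apply: (mulfI (lt0r_neq0 r_gt0)).
  apply: (mulIf (lt0r_neq0 (divr_gt0 ltr01 mu_gt0))).
  transitivity (lambda / mu * (r * pi U) * (nb_adjunctions U V)%:R).
    by rewrite mul1r; ring.
  by rewrite E; field; exact: lt0r_neq0.
by rewrite !jump_rateE !mulrDr (bal S T) (bal T S) addrC.
Qed.

Lemma esum_stationary (f : tree -> R) : (forall T, 0 <= f T) ->
  (\esum_(T in [set: tree]) (pi T * f T)%:E =
   (r^-1)%:E * \esum_(t in [set: plane_tree])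
     ((weight rho t)%:E * (f (\pi_tree t))%:E))%E.
Proof.
move=> f0; rewrite (esum_fiber \pi_tree); last first.
  by move=> t; rewrite mule_ge0// lee_fin.
rewrite -esumZl ?invr_ge0 ?(ltW r_gt0)//; last first.
  by move=> T; rewrite esum_ge0// => t _; rewrite mule_ge0// lee_fin.
apply: eq_esum => T _; rewrite [X in (_ * X)%E](_ : _ = (r * pi T * f T)%:E).
  by rewrite -EFinM; congr _%:E; field; exact: lt0r_neq0.
by rewrite EFinM -tree_weightE -esumZr//; apply: eq_esum => t /= ->.
Qed.

Lemma esum_stationary1 : (\esum_(T in [set: tree]) (pi T)%:E = 1)%E.
Proof.
transitivity (\esum_(T in [set: tree]) (pi T * 1)%:E)%E.
  by apply: eq_esum => T _; rewrite mulr1.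
rewrite (esum_stationary (f := fun=> 1))//.
rewrite [X in (_ * X)%E](_ : _ = r%:E).
  by rewrite -EFinM mulVf// lt0r_neq0.
rewrite -(esum_weight rho_gt0 rE r_min).
by apply: eq_esum => t _; rewrite mule1.
Qed.

Lemma esum_stationary_volume_eq k : (1 <= k)%N ->
  (\esum_(T in [set T | volume T = k]) (pi T)%:E =
   (r^-1 * (k%:R ^+ k.-1 / k`!%:R) * rho ^+ k)%:E)%E.
Proof.
move=> k1; rewrite -mulrA EFinM -(esum_weight_eq_volume rho_gt0 k1).
transitivity (\esum_(T in [set: tree]) (pi T * (volume T == k)%:R)%:E)%E.
  rewrite esum_mkcond; apply: eq_esum => T _.
  have [Tk|/eqP Tk] := eqVneq; first by rewrite mem_set// mulr1.
  by rewrite memNset// mulr0.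
rewrite (esum_stationary (f := fun T => (volume T == k)%:R))//.
congr (_ * _)%E; rewrite [RHS]esum_mkcond; apply: eq_esum => t _.
rewrite volume_pi.
have [tk|/eqP tk] := eqVneq; first by rewrite mem_set// mule1.
by rewrite memNset// mule0.
Qed.

Lemma esum_stationary_volume :
  (\esum_(T in [set: tree]) (pi T * (volume T)%:R)%:E =
   if r == 1%R then +oo else ((1 - r)^-1)%:E)%E.
Proof.
rewrite (esum_stationary (f := fun T => (volume T)%:R))//.
rewrite [X in (_ * X)%E](_ : _ = \esum_(t in [set: plane_tree])
    ((weight rho t)%:E * (plane_volume t)%:R%:E)%E); last first.
  by apply: eq_esum => t _; rewrite volume_pi.
rewrite (esum_weight_volume rho_gt0 rE r_min)//.
case: eqP => [->|/eqP r1]; first by rewrite invr1 mul1e.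
rewrite -EFinM mulrA mulVf ?mul1r// lt0r_neq0//.
Qed.

(** A tree [T] of volume above 1 has a deletion [S]. Since the weights are positive, [tree_balance]
    forces [T] to be among the finitely many adjunctions of the smaller tree [S]. *)
Lemma finite_volume_le n : finite_set [set T | (volume T <= n)%N].
Proof.
elim: n => [|n IH].
  rewrite (_ : [set T | _] = set0)//; apply/seteqP; split => T //=.
  by rewrite leqNgt volume_gt0.
apply: (@sub_finite_set _ _ ([set root_tree] `|`
   \bigcup_(S in [set S | (volume S <= n)%N])
     [set` map \pi_tree (adjunctions (repr S))])); last first.
  rewrite finite_setU; split; first exact: finite_set1.
  by apply: bigcup_finite => // S _; exact: finite_seq.
move=> T /= Tn; have [T1|/exists_deletion[S ST dS]] := leqP (volume T) 1.
  by left; exact: volume_le1.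
right; exists S; first by rewrite /= -ltnS ST.
rewrite /= -count_pi_gt0 lt0n; apply/negP => /eqP aS.
have := tree_balance rho_gt0 S T; rewrite /nb_adjunctions aS mule0 => /esym/eqP.
rewrite tree_weightE -EFinM eqe mulf_eq0 mulf_eq0 pnatr_eq0.
by rewrite !gt_eqF// stationary_gt0.
Qed.

End Rates.

(** * Reversibility of the transition function *)

Lemma exists_volume_le (R : realType) (n : nat) (lambda mu r : R) :
  0 < lambda -> 0 < mu -> r * expR (- r) = lambda / mu ->
  (forall s, s * expR (- s) = lambda / mu -> r <= s) ->
  exists2 W : seq tree, uniq W & forall T, (T \in W) = (volume T <= n)%N.
Proof.
move=> l0 m0 rE r_min.
have /finite_seqP[s sE] := finite_volume_le l0 m0 rE r_min n.
exists (undup s) => [|T]; first exact: undup_uniq.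
rewrite mem_undup; apply/idP/idP => Ts.
  by have : [set` s] T by []; rewrite -sE.
by have : [set T | (volume T <= n)%N] T by []; rewrite sE.
Qed.

(** * Errors of order o(h) at time 0 *)

Section SmallO.
Variable R : realType.
Implicit Types g : R -> R.

Definition small_at0 g := forall eps, 0 < eps ->
  \forall h \near 0^'+, g h <= eps * h.

Lemma small_at0D g1 g2 :
  small_at0 g1 -> small_at0 g2 -> small_at0 (fun h => g1 h + g2 h).
Proof.
move=> H1 H2 eps e0; near=> h; rewrite [eps]splitr mulrDl lerD//.
  by near: h; apply: H1; rewrite divr_gt0.
by near: h; apply: H2; rewrite divr_gt0.
Unshelve. all: end_near. Qed.

Lemma small_at0Z (c : R) g : 0 <= c -> small_at0 g ->
  small_at0 (fun h => c * g h).
Proof.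
move=> c0 H eps e0; near=> h.
have h0 : 0 < h by [].
(* [c + 1] because [c] may be 0. *)
have : g h <= eps / (c + 1) * h.
  by near: h; apply: H; rewrite divr_gt0// ltr_wpDl.
move=> gh; apply: (@le_trans _ _ (c * (eps / (c + 1) * h))).
  exact: ler_wpM2l.
rewrite mulrA ler_pM2r// mulrCA ler_piMr ?(ltW e0)//.
by rewrite ler_pdivrMr ?mul1r ?lerDl// ltr_wpDl.
Unshelve. all: end_near. Qed.

Lemma small_at0_sum (I : Type) (s : seq I) (P : pred I) (g : I -> R -> R) :
  (forall i, small_at0 (g i)) ->
  small_at0 (fun h => \sum_(i <- s | P i) g i h).
Proof.
move=> gs; elim: s => [|i s IH].
  by move=> eps e0; near=> h; rewrite big_nil mulr_ge0// ltW.
have [Pi|Pi] := boolP (P i); last first.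
  move=> eps e0; near=> h; rewrite big_cons (negbTE Pi).
  by near: h; exact: IH.
move=> eps e0; near=> h; rewrite big_cons Pi.
by near: h; apply: small_at0D.
Unshelve. all: end_near. Qed.

Lemma small_at0_derivative (f : R -> R) (l : R) :
  (f h - f 0) / h @[h --> 0^'+] --> l ->
  small_at0 (fun h => `|f h - f 0 - h * l|).
Proof.
move=> /cvgrPdist_le fl eps e0; near=> h.
have h0 : 0 < h by [].
have -> : `|f h - f 0 - h * l| = `|l - (f h - f 0) / h| * h.
  rewrite -[X in _ = _ * X](gtr0_norm h0) -normrM mulrBl divfK ?gt_eqF//.
  by rewrite distrC [l * h]mulrC.
by rewrite ler_pM2r//; near: h; exact: fl.
Unshelve. all: end_near. Qed.

End SmallO.

Section Generator.
Variables (R : realType) (lambda mu r : R).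
Hypotheses (lambda_gt0 : 0 < lambda) (mu_gt0 : 0 < mu).
Hypothesis rE : r * expR (- r) = lambda / mu.
Hypothesis r_min : forall s, s * expR (- s) = lambda / mu -> r <= s.
Local Notation jump := (jump_rate lambda mu).
Local Notation Q := (Qmatrix lambda mu).
Local Notation pi := (stationary lambda mu r).
Let pi0 T : 0 <= pi T. Proof. exact: stationary_ge0. Qed.

Variable p : R -> tree -> tree -> R.
Hypothesis pQ : is_transition_function Q p.

Let p0 t S T : 0 <= t -> 0 <= p t S T.
Proof. exact: (transition_ge0 pQ). Qed.

Lemma transition_sum_le1 t S (s : seq tree) : 0 <= t -> uniq s ->
  \sum_(T <- s) p t S T <= 1.
Proof.
move=> t0 us; rewrite -lee_fin -(transition_sum1 pQ S t0) -sumEFin.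
apply: esum_fin_ge => // T; rewrite lee_fin; exact: p0.
Qed.

Lemma transition_le1 t S T : 0 <= t -> p t S T <= 1.
Proof.
by move=> t0; have := @transition_sum_le1 t S [:: T] t0 isT; rewrite big_seq1.
Qed.

(** The Chapman-Kolmogorov terms outside [L] carry a factor p s V T <= 1, so together they are at
    most the mass that p h U puts outside [L]. *)
Lemma transition_split h s U T (L : seq tree) : 0 <= h -> 0 <= s -> uniq L ->
  0 <= p (h + s) U T - \sum_(V <- L) p h U V * p s V T <=
  1 - \sum_(V <- L) p h U V.
Proof.
move=> h0 s0 uL.
have := transition_sum1 pQ U h0; rewrite (esum_split uL); last first.
  by move=> V; exact: p0.
have := transitionD pQ U T h0 s0; rewrite (esum_split uL); last first.
  by move=> V; rewrite mulr_ge0// p0.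
set X := esum _ _; set Y := esum _ _.
have X0 : (0 <= X)%E.
  by apply: esum_ge0 => V _; rewrite lee_fin mulr_ge0// p0.
have XY : (X <= Y)%E.
  apply: le_esum => V _; rewrite lee_fin ler_piMr ?p0//.
  exact: transition_le1.
case: X X0 XY => [x| |]// x0; case: Y => [y| |]// xy.
move: x0 xy; rewrite !lee_fin => x0 xy.
by rewrite -!EFinD => -[->] -[<-]; rewrite ![_ + _ - _]addrAC !subrr !add0r x0.
Qed.

Definition generator (a : tree -> R) (U : tree) : R :=
  \sum_(V <- moves U) jump U V * (a V - a U).

(** Derivatives at 0 are known entry by entry, so the sum is confined to [U] and its finitely many
    neighbours; the mass elsewhere is controlled through total mass 1. *)
Definition step_error (U : tree) (h : R) : R :=
  \sum_(V <- U :: moves U) `|p h U V - p 0 U V - h * Q U V|.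

Lemma step_error_small U : small_at0 (step_error U).
Proof.
apply: small_at0_sum => V.
apply: (small_at0_derivative (f := fun h => p h U V)).
exact: (transition_derivative pQ).
Qed.

Lemma sum_Qmatrix U (a : tree -> R) :
  \sum_(V <- U :: moves U) Q U V * a V = generator a U.
Proof.
rewrite big_cons /Qmatrix eqxx -sum_jump_rate mulNr mulr_suml addrC -sumrB.
rewrite big_seq [RHS]big_seq; apply: eq_bigr => V VU.
rewrite ifN; first by rewrite mulrBr.
by apply: contraNneq (moves_irr U) => E; rewrite -{1}E.
Qed.

Lemma sum_transition0 U (a : tree -> R) :
  \sum_(V <- U :: moves U) p 0 U V * a V = a U.
Proof.
rewrite big_cons (transition0 pQ) eqxx mul1r big1_seq ?addr0// => V /= VU.
rewrite (transition0 pQ); case: eqP => [E|]; last by rewrite mul0r.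
by move: VU (moves_irr U); rewrite -E => ->.
Qed.

(* The error is o(h) uniformly in s and T: this makes it possible to compare
   products of transition probabilities by telescoping over small time steps,
   without differentiating p at positive times. *)
Lemma transition_step h s U T : 0 <= h -> 0 <= s ->
  `|p (h + s) U T - p s U T - h * generator (fun V => p s V T) U| <=
  2 * step_error U h.
Proof.
move=> h0 s0; set L := U :: moves U.
have uL : uniq L by rewrite /= moves_irr moves_uniq.
have /andP[lo up] := transition_split U T h0 s0 uL.
pose d V := p h U V - p 0 U V - h * Q U V.
have sumd (a : tree -> R) : \sum_(V <- L) d V * a V =
    \sum_(V <- L) p h U V * a V - a U - h * generator a U.
  rewrite -{1}(sum_transition0 U a) -sum_Qmatrix mulr_sumr -!sumrB.
  by apply: eq_bigr => V _; rewrite /d !mulrBl mulrA.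
(* The mass escaping from [L] is of the same order: the row of Q sums to 0 over [L], so 1 minus the
   mass in [L] is minus the sum of the errors [d V]. This accounts for one of the two
   [step_error]. *)
have {}up : p (h + s) U T - \sum_(V <- L) p h U V * p s V T <= step_error U h.
  apply: (le_trans up); have := sumd (fun=> 1).
  have -> : generator (fun=> 1) U = 0.
    by rewrite /generator big1// => V _; rewrite subrr mulr0.
  rewrite mulr0 subr0 => E.
  rewrite (_ : 1 - _ = - \sum_(V <- L) d V * 1); last first.
    by rewrite E opprB; congr (_ - _); apply: eq_bigr => V _; rewrite mulr1.
  apply: le_trans (ler_norm _) _; rewrite normrN.
  apply: le_trans (ler_norm_sum _ _ _) _.
  by apply: ler_sum => V _; rewrite mulr1.
have := sumd (fun V => p s V T).
set a := fun V => p s V T => E.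
have a1 : `|\sum_(V <- L) d V * a V| <= step_error U h.
  apply: le_trans (ler_norm_sum _ _ _) _; apply: ler_sum => V _.
  rewrite normrM ler_piMr// ger0_norm ?transition_le1//.
  exact: p0.
rewrite (_ : _ - _ = (p (h + s) U T - \sum_(V <- L) p h U V * p s V T) +
    \sum_(V <- L) d V * a V); last by rewrite E /a; ring.
rewrite mulrDl mul1r; apply: le_trans (ler_normD _ _) _; apply: lerD => //.
by rewrite ger0_norm.
Qed.

(** By detailed balance [pi U * F U V] is antisymmetric, so the jumps inside [W] cancel. Those
    leaving [W] start at volume [n], and a V b U - a U b V has absolute value at most 1. *)
Lemma flux_le n (W : seq tree) (a b : tree -> R) : uniq W ->
  (forall T, (T \in W) = (volume T <= n)%N) ->
  (forall T, 0 <= a T <= 1) -> (forall T, 0 <= b T <= 1) ->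
  `|\sum_(U <- W) pi U * (generator a U * b U - a U * generator b U)| <=
  lambda * n%:R * \sum_(U <- W | volume U == n) pi U.
Proof.
move=> uW memW a01 b01.
pose F U V := jump U V * (a V * b U - a U * b V).
have genE U : generator a U * b U - a U * generator b U =
    \sum_(V <- W) F U V + \sum_(V <- moves U | (n < volume V)%N) F U V.
  transitivity (\sum_(V <- moves U) F U V).
    rewrite mulr_suml mulr_sumr -sumrB; apply: eq_bigr => V _; rewrite /F; ring.
  rewrite (bigID (fun V => volume V <= n)%N) /=; congr (_ + _); last first.
    by apply: eq_bigl => V; rewrite ltnNge.
  transitivity (\sum_(V <- W | V \in moves U) F U V).
    rewrite -big_filter -[RHS]big_filter; apply: perm_big.
    apply: uniq_perm; rewrite ?filter_uniq ?moves_uniq// => V.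
    by rewrite !mem_filter memW andbC.
  rewrite big_mkcond; apply: eq_bigr => V _; case: ifPn => // VU.
  by rewrite /F jump_rate_moves// mul0r.
under eq_bigr do rewrite genE mulrDr.
rewrite big_split /=.
have -> : \sum_(U <- W) pi U * \sum_(V <- W) F U V = 0.
  pose X := \sum_(U <- W) pi U * \sum_(V <- W) F U V.
  have XE : X = \sum_(U <- W) \sum_(V <- W) pi U * F U V.
    by apply: eq_bigr => U _; rewrite mulr_sumr.
  have : X = - X.
    rewrite {1}XE exchange_big XE -sumrN; apply: eq_bigr => V _ /=.
    rewrite -sumrN; apply: eq_bigr => U _.
    rewrite /F !mulrA (stationary_balance lambda_gt0 mu_gt0 rE r_min U V); ring.
  by rewrite -/X; lra.
rewrite add0r; apply: le_trans (ler_norm_sum _ _ _) _.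
rewrite [leRHS]mulrC mulr_suml big_mkcond [leRHS]big_mkcond /=.
rewrite big_seq [leRHS]big_seq; apply: ler_sum => U; rewrite memW => Un.
rewrite normrM ger0_norm//.
have : `|\sum_(V <- moves U | (n < volume V)%N) F U V| <=
    if volume U == n then lambda * n%:R else 0.
  apply: le_trans _ (sum_jump_rate_gt mu lambda_gt0 Un).
  apply: le_trans (ler_norm_sum _ _ _) _; apply: ler_sum => V _.
  rewrite normrM ger0_norm ?jump_rate_ge0// ler_piMr ?jump_rate_ge0//.
  have [/andP[aU0 aU1] /andP[aV0 aV1]] := (a01 U, a01 V).
  have [/andP[bU0 bU1] /andP[bV0 bV1]] := (b01 U, b01 V).
  rewrite ler_norml; apply/andP; split; nra.
case: eqP => _ Fle; first exact: ler_wpM2l.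
by rewrite (le_trans (ler_wpM2l (pi0 U) Fle))// mulr0.
Qed.

End Generator.

Lemma liminf_mul_summable (R : realType) (f : nat -> R) (c : R) :
  (forall n, 0 <= f n) -> (forall K, \sum_(k < K) f k <= c) ->
  forall eps n0, 0 < eps -> exists2 n, (n0 <= n)%N & n%:R * f n < eps.
Proof.
move=> f0 fc eps n0 e0; apply: contrapT => noex.
have f_ge n : (n0 <= n)%N -> eps <= n%:R * f n.
  by move=> n0n; rewrite leNgt; apply/negP => ?; apply: noex; exists n.
apply: (@dvg_harmonic R); apply: nondecreasing_is_cvgn.
  by apply/nondecreasing_seqP => n; rewrite seriesEnat /= big_nat_recr//= lerDl.
(* The first [n0] terms of the harmonic series are at most 1 each; by [f_ge] every later one is at
   most the matching value of [f] divided by [eps]. *)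
exists (n0%:R + c / eps) => _ [K _ <-]; rewrite seriesEnat /= big_mkord.
have sumE (g : nat -> R) : \sum_(i < K) g i.+1 <= \sum_(i < K.+1) g i - g 0%N.
  by rewrite big_ord_recl addrC addKr.
apply: (@le_trans _ _ (\sum_(i < K) ((i < n0)%:R + f i.+1 / eps))).
  apply: ler_sum => i _; case: ltnP => i_n0.
    apply: (@le_trans _ _ 1); last by rewrite lerDl divr_ge0// ltW.
    by rewrite invf_le1 ?ltr0n// ler1n.
  rewrite add0r ler_pdivlMr// ler_pdivrMl ?ltr0n//.
  by apply: f_ge; rewrite (leq_trans i_n0).
rewrite big_split lerD//=.
  rewrite -natr_sum ler_nat (_ : (\sum_(i < K) _ = minn K n0)%N) ?geq_minr//.
  elim: {sumE}K => [|K IH]; first by rewrite big_ord0 min0n.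
  rewrite big_ord_recr /= IH; case: ltnP; lia.
rewrite -mulr_suml ler_pM2r ?invr_gt0//.
by rewrite (le_trans (sumE f))// lerBlDr (le_trans (fc _))// lerDl.
Qed.

Section Reversibility.
Variables (R : realType) (lambda mu r : R).
Hypotheses (lambda_gt0 : 0 < lambda) (mu_gt0 : 0 < mu).
Hypothesis rE : r * expR (- r) = lambda / mu.
Hypothesis r_min : forall s, s * expR (- s) = lambda / mu -> r <= s.
Local Notation pi := (stationary lambda mu r).
Let pi_ge0 T : 0 <= pi T. Proof. exact: stationary_ge0. Qed.

(** At k = 0 the formula would give r^-1, whereas no tree is empty. *)
Definition volume_law (k : nat) : R :=
  if k is 0%N then 0 else r^-1 * (k%:R ^+ k.-1 / k`!%:R) * (lambda / mu) ^+ k.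

Lemma esum_volume_law k :
  (\esum_(T in [set T | volume T = k]) (pi T)%:E = (volume_law k)%:E)%E.
Proof.
case: k => [|k]; last exact: esum_stationary_volume_eq.
rewrite (_ : [set T | _] = set0) ?esum_set0//; apply/seteqP; split => T //= T0.
by have := volume_gt0 T; rewrite T0.
Qed.

Lemma volume_law_ge0 k : 0 <= volume_law k.
Proof.
by rewrite -lee_fin -esum_volume_law esum_ge0// => T _; rewrite lee_fin.
Qed.

Lemma esum_volume_law1 :
  (\esum_(k in [set: nat]) (volume_law k)%:E = 1)%E.
Proof.
rewrite -(esum_stationary1 lambda_gt0 mu_gt0 rE r_min) (esum_fiber volume)//.
by apply: eq_esum => k _; rewrite -esum_volume_law.
Qed.

Lemma sum_volume_law n (W : seq tree) : uniq W ->
  (forall T, (T \in W) = (volume T <= n)%N) ->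
  \sum_(T <- W | volume T == n) pi T = volume_law n.
Proof.
move=> uW memW; apply: EFin_inj; rewrite -esum_volume_law esum_mkcond.
rewrite big_mkcond (@esum_fin_supp _ _ _ W)//.
- rewrite -sumEFin; apply: eq_bigr => T _.
  by have [Tn|/eqP Tn] := eqVneq; [rewrite mem_set|rewrite memNset].
- by move=> T; case: ifP => // _; rewrite lee_fin.
- move=> T; rewrite memW => Tn; rewrite memNset// => /= E.
  by rewrite E leqnn in Tn.
Qed.

Lemma volume_law_liminf eps n0 : 0 < eps ->
  exists2 n, (n0 <= n)%N & n%:R * volume_law n < eps.
Proof.
apply: (liminf_mul_summable (c := 1)) => [|K]; first exact: volume_law_ge0.
rewrite -lee_fin -esum_volume_law1 -sumEFin.
rewrite -(big_mkord xpredT (fun k => (volume_law k)%:E)).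
rewrite /index_iota subn0; apply: esum_fin_ge; rewrite ?iota_uniq// => k.
by rewrite lee_fin volume_law_ge0.
Qed.

Variable p : R -> tree -> tree -> R.
Hypothesis pQ : is_transition_function (Qmatrix lambda mu) p.
Let p0 t S T : 0 <= t -> 0 <= p t S T.
Proof. exact: (transition_ge0 pQ). Qed.

Lemma reversibility_defect t S T n : 0 < t ->
  (volume S <= n)%N -> (volume T <= n)%N ->
  `|pi T * p t T S - pi S * p t S T| <= t * (lambda * n%:R * volume_law n).
Proof.
move=> t0 Sn Tn.
have [W uW memW] := exists_volume_le n lambda_gt0 mu_gt0 rE r_min.
set B := lambda * _ * _.
(* 4 = 2 + 2: [transition_step] costs 2 for each of the two factors. *)
pose E h := \sum_(U <- W) (pi U * 4) * step_error lambda mu p U h.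
have Esmall : small_at0 E.
  apply: small_at0_sum => U; apply: small_at0Z; last exact: step_error_small.
  by rewrite mulr_ge0.
(* A time h is carried from one factor to the other. At first order the change is h times the flux,
   bounded by [B]; the rest is o(h) uniformly in s and s'. *)
have step h s s' : 0 <= h -> 0 <= s -> 0 <= s' ->
    `|\sum_(U <- W) pi U * (p (h + s) U S * p s' U T) -
      \sum_(U <- W) pi U * (p s U S * p (h + s') U T)| <= h * B + E h.
  move=> h0 s0 s'0.
  pose a U := p s U S; pose b U := p s' U T.
  pose ga := generator lambda mu a; pose gb := generator lambda mu b.
  rewrite -sumrB.
  rewrite (_ : \sum_(U <- W) _ = \sum_(U <- W)
      (h * (pi U * (ga U * b U - a U * gb U)) +
       pi U * ((p (h + s) U S - p s U S - h * ga U) * b U -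
               (p (h + s') U T - p s' U T - h * gb U) * a U))); last first.
    by apply: eq_bigr => U _; rewrite /a /b; ring.
  rewrite big_split /= -mulr_sumr; apply: le_trans (ler_normD _ _) _.
  have p01 u V X : 0 <= u -> 0 <= p u V X <= 1.
    by move=> u0; rewrite p0// (transition_le1 pQ).
  apply: lerD.
    rewrite normrM ger0_norm// ler_wpM2l// /B -(sum_volume_law uW memW).
    by apply: (flux_le lambda_gt0 mu_gt0 rE r_min uW memW) => U; exact: p01.
  apply: le_trans (ler_norm_sum _ _ _) _; apply: ler_sum => U _.
  rewrite normrM ger0_norm// -mulrA ler_wpM2l//.
  have -> : 4 = 2 + 2 :> R by rewrite -natrD.
  rewrite [leRHS]mulrDl; apply: le_trans (ler_normB _ _) _; rewrite !normrM.
  have norm_le1 u V X : 0 <= u -> `|p u V X| <= 1.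
    by move=> u0; have /andP[? ?] := p01 u V X u0; rewrite ger0_norm.
  apply: lerD.
    rewrite -[leRHS]mulr1 ler_pM//; last exact: norm_le1.
    exact: (transition_step pQ).
  rewrite -[leRHS]mulr1 ler_pM//; last exact: norm_le1.
  exact: (transition_step pQ).
apply/ler_addgt0Pr => eps e0.
have /Esmall : 0 < eps / t by rewrite divr_gt0.
rewrite /at_right /within /= => /nbhs_ballP[d /= d0 dE].
(* Equal steps shorter than [d], where E h <= eps / t * h; the N errors then add up to at most
   eps. *)
pose N := (Num.truncn (t / d)).+1; pose h := t / N%:R.
have N0 : 0 < N%:R :> R by rewrite ltr0n.
have h0 : 0 < h by rewrite divr_gt0.
have hd : h < d by rewrite ltr_pdivrMr// mulrC -ltr_pdivrMr// truncnS_gt.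
have Eh : E h <= eps / t * h.
  by apply: dE => //=; rewrite /ball /= sub0r normrN gtr0_norm.
pose I k := \sum_(U <- W) pi U * (p (h * k%:R) U S * p (h * (N - k)%:R) U T).
have hN : h * N%:R = t by rewrite divfK// gt_eqF.
have I0 : I 0%N = pi S * p t S T.
  rewrite /I mulr0 subn0 hN (bigD1_seq S) ?memW//=.
  rewrite (transition0 pQ) eqxx mul1r big1 ?addr0// => U /negbTE US.
  by rewrite (transition0 pQ) US mul0r mulr0.
have IN : I N = pi T * p t T S.
  rewrite /I subnn mulr0 hN (bigD1_seq T) ?memW//=.
  rewrite (transition0 pQ) eqxx mulr1 big1 ?addr0// => U /negbTE UT.
  by rewrite (transition0 pQ) UT !mulr0.
rewrite -I0 -IN -(@telescope_sumr _ 0 N)//.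
apply: le_trans (ler_norm_sum _ _ _) _.
apply: (@le_trans _ _ (\sum_(0 <= k < N) (h * B + E h))).
  rewrite !big_nat; apply: ler_sum => k /= kN; rewrite /I.
  rewrite -natr1 mulrDr mulr1 [_ + h]addrC.
  have -> : (N - k = (N - k.+1).+1)%N by rewrite subnSK.
  rewrite -[(N - k.+1).+1%:R]natr1 [h * (_ + 1)]mulrDr mulr1 [_ + h]addrC.
  by apply: step; rewrite ?mulr_ge0// ltW.
rewrite big_const_nat subn0 iter_addr_0 -mulr_natl mulrDr mulrA [_ * h]mulrC hN.
rewrite lerD2l (le_trans (ler_wpM2l (ltW N0) Eh))//.
by rewrite mulrCA [N%:R * h]mulrC hN divfK// gt_eqF.
Qed.

Lemma transition_reversible t S T : 0 <= t ->
  pi S * p t S T = pi T * p t T S.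
Proof.
rewrite le_eqVlt => /predU1P[<-|t0].
  by rewrite !(transition0 pQ) eq_sym; case: eqP => [->|]; rewrite ?mulr0.
apply/esym/eqP; rewrite -subr_eq0 -normr_le0; apply/ler_addgt0Pr => eps e0.
rewrite add0r.
have e'0 : 0 < eps / (t * lambda) by rewrite divr_gt0// mulr_gt0.
have [n] := volume_law_liminf (maxn (volume S) (volume T)) e'0.
rewrite geq_max => /andP[Sn Tn] nE.
apply: le_trans (reversibility_defect t0 Sn Tn) _.
have -> : t * (lambda * n%:R * volume_law n) =
    t * lambda * (n%:R * volume_law n).
  ring.
by rewrite -ler_pdivlMl ?mulr_gt0// [leRHS]mulrC ltW.
Qed.

End Reversibility.

(** * Convergence of the transition function *)

Section Convergence.
Variables (R : realType) (lambda mu r : R).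
Hypotheses (lambda_gt0 : 0 < lambda) (mu_gt0 : 0 < mu).
Hypothesis rE : r * expR (- r) = lambda / mu.
Hypothesis r_min : forall s, s * expR (- s) = lambda / mu -> r <= s.
Local Notation pi := (stationary lambda mu r).
Let pi_gt0 T : 0 < pi T. Proof. exact: stationary_gt0. Qed.
Let pi_ge0 T : 0 <= pi T. Proof. exact: stationary_ge0. Qed.

Variable p : R -> tree -> tree -> R.
Hypothesis pQ : is_transition_function (Qmatrix lambda mu) p.
Let p0 t S T : 0 <= t -> 0 <= p t S T.
Proof. exact: (transition_ge0 pQ). Qed.
Let pi_rev t S T : 0 <= t -> pi S * p t S T = pi T * p t T S.
Proof. exact: (transition_reversible lambda_gt0 mu_gt0 rE r_min pQ). Qed.

Variable o : tree.

Definition density (t : R) (T : tree) : R := p t o T / pi T.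
Local Notation u := density.

(** Read backwards, the density is a function of the starting point, so the semigroup acts on it:
    applying p_s to u_t gives u_(s+t). *)
Lemma density_rev t T : 0 <= t -> u t T = p t T o / pi o.
Proof.
move=> t0; apply: (mulIf (lt0r_neq0 (pi_gt0 T))).
rewrite /u divfK ?lt0r_neq0// mulrAC [_ * pi T]mulrC -pi_rev//.
by rewrite mulrAC divff ?mul1r// lt0r_neq0.
Qed.

Lemma density_ge0 t T : 0 <= t -> 0 <= u t T.
Proof. by move=> t0; rewrite divr_ge0// p0. Qed.

(* The sum of the left-hand side over all S and T is the right-hand side. *)
Lemma dirichlet_le h t S T : 0 <= h -> 0 <= t ->
  pi S * p h S T * (u t S - u t T) ^+ 2 <= 2 * (u (t + t) o - u (t + t + h) o).
Proof.
move=> h0 t0; have pio0 : pi o != 0 by exact: lt0r_neq0.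
have ht0 : 0 <= h + t by rewrite addr_ge0.
have iter s x : 0 <= s ->
    (\esum_(y in [set: tree]) (p s x y * u t y)%:E =
     (p (s + t) x o / pi o)%:E)%E.
  move=> s0; rewrite EFinM (transitionD pQ x o s0 t0).
  rewrite -esumZr ?invr_ge0//; last first.
    by move=> y; rewrite lee_fin mulr_ge0// p0.
  by apply: eq_esum => y _; rewrite density_rev// -EFinM mulrA.
pose a x y := pi x * p h x y.
have a0 x y : 0 <= a x y by rewrite mulr_ge0// p0.
have u0 x : 0 <= u t x by exact: density_ge0.
(* One factor u is read as p t o x / pi x, the other as p t x o / pi o: Chapman-Kolmogorov then
   closes a loop at [o]. *)
have square : (\esum_(x in [set: tree]) (pi x * u t x ^+ 2)%:E =
    (u (t + t) o)%:E)%E.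
  rewrite -[u (t + t) o]/(p (t + t) o o / pi o) -(iter t o t0).
  apply: eq_esum => x _; congr _%:E; rewrite expr2 {1}/u.
  by rewrite mulrA [pi x * _]mulrCA divff ?mulr1// lt0r_neq0.
have A : (\esum_(x in [set: tree]) \esum_(y in [set: tree])
    (a x y * u t x ^+ 2)%:E = (u (t + t) o)%:E)%E.
  rewrite -square; apply: eq_esum => x _.
  have piu0 : 0 <= pi x * u t x ^+ 2 by rewrite mulr_ge0// sqr_ge0.
  rewrite -[RHS]mule1 -(transition_sum1 pQ x h0) -esumZl//.
    by apply: eq_esum => y _; rewrite -EFinM /a; congr _%:E; ring.
  by move=> y; rewrite lee_fin p0.
have B : (\esum_(x in [set: tree]) \esum_(y in [set: tree])
    (a x y * u t y ^+ 2)%:E = (u (t + t) o)%:E)%E.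
  rewrite -A esum_exchange => [|x y]; last first.
    by rewrite lee_fin mulr_ge0// sqr_ge0.
  by apply: eq_esum => x _; apply: eq_esum => y _; rewrite /a pi_rev.
have C : (\esum_(x in [set: tree]) \esum_(y in [set: tree])
    (2 * (a x y * (u t x * u t y)))%:E = (2 * u (t + t + h) o)%:E)%E.
  transitivity (\esum_(x in [set: tree])
      (2 * p t o x * (p (h + t) x o / pi o))%:E)%E.
    have pt0 x : 0 <= 2 * p t o x by rewrite mulr_ge0// p0.
    apply: eq_esum => x _; rewrite EFinM -(iter h x h0) -esumZl//.
      apply: eq_esum => y _; rewrite -EFinM; congr _%:E.
      rewrite /a {1}/u; field; exact: lt0r_neq0.
    by move=> y; rewrite lee_fin mulr_ge0// p0.
  transitivity (\esum_(x in [set: tree])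
      ((2 / pi o)%:E * (p t o x * p (h + t) x o)%:E))%E.
    by apply: eq_esum => x _; rewrite -EFinM; congr _%:E; ring.
  have c0 : 0 <= 2 / pi o by rewrite divr_ge0.
  rewrite esumZl//; last by move=> x; rewrite lee_fin mulr_ge0// p0.
  rewrite -(transitionD pQ o o t0 ht0) -EFinM; congr _%:E.
  by rewrite /u (_ : t + (h + t) = t + t + h); ring.
pose D x y := a x y * (u t x - u t y) ^+ 2.
have D0 x y : 0 <= D x y by rewrite mulr_ge0// sqr_ge0.
have ac0 x y : 0 <= 2 * (a x y * (u t x * u t y)).
  by rewrite mulr_ge0// mulr_ge0// mulr_ge0.
(* The expanded square, with the cross term on the left so that no subtraction of extended reals
   occurs. *)
have sumD : (\esum_(x in [set: tree]) \esum_(y in [set: tree]) (D x y)%:E +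
    (2 * u (t + t + h) o)%:E = (u (t + t) o)%:E + (u (t + t) o)%:E)%E.
  rewrite -{2}B -A -C -!esumD.
  - apply: eq_esum => x _; rewrite -!esumD.
    + by apply: eq_esum => y _; rewrite -!EFinD /D; congr _%:E; ring.
    + by move=> y _; rewrite lee_fin mulr_ge0// sqr_ge0.
    + by move=> y _; rewrite lee_fin mulr_ge0// sqr_ge0.
    + by move=> y _; rewrite lee_fin.
    + by move=> y _; rewrite lee_fin.
  - by move=> x _; apply: esum_ge0 => y _; rewrite lee_fin mulr_ge0// sqr_ge0.
  - by move=> x _; apply: esum_ge0 => y _; rewrite lee_fin mulr_ge0// sqr_ge0.
  - by move=> x _; apply: esum_ge0 => y _; rewrite lee_fin.
  - by move=> x _; apply: esum_ge0 => y _; rewrite lee_fin.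
have DST : ((D S T)%:E <=
    \esum_(x in [set: tree]) \esum_(y in [set: tree]) (D x y)%:E)%E.
  apply: le_trans (esum_term_le S _) => [|x]; last first.
    by apply: esum_ge0 => y _; rewrite lee_fin.
  by apply: (esum_term_le (f := fun y => (D S y)%:E)) => y; rewrite lee_fin.
move: DST; rewrite -(leeD2rE (x := (2 * u (t + t + h) o)%:E))//.
rewrite sumD -!EFinD lee_fin.
rewrite /D /a; lra.
Qed.

Lemma density_nonincreasing s h : 0 <= s -> 0 <= h -> u (s + h) o <= u s o.
Proof.
move=> s0 h0; have s20 : 0 <= s / 2 by rewrite divr_ge0.
have := dirichlet_le o o h0 s20; rewrite subrr expr0n mulr0 -splitr.
by rewrite pmulr_rge0// subr_ge0.
Qed.

Lemma density_cvg : exists L : R, u t o @[t --> +oo] --> L.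
Proof.
(* Monotonicity holds from time 0 on; [Num.max t 0] extends it to the whole line. *)
have /nondecreasing_cvgr H :
    {homo (fun t => - u (Num.max t 0) o) : x y / x <= y}.
  move=> x y xy; rewrite lerN2.
  have mxy : Num.max x 0 <= Num.max y 0 by rewrite ge_max !le_max xy lexx orbT.
  rewrite -(subrK (Num.max x 0) (Num.max y 0)) addrC.
  by apply: density_nonincreasing; rewrite ?subr_ge0// le_max lexx orbT.
have {}H : - u (Num.max t 0) o @[t --> +oo] -->
    sup (range (fun t => - u (Num.max t 0) o)).
  apply: H; exists 0 => _ [t _ <-]; rewrite oppr_le0 density_ge0//.
  by rewrite le_max lexx orbT.
exists (- sup (range (fun t => - u (Num.max t 0) o))).
apply: cvg_trans (cvgN H); apply: near_eq_cvg; near=> t.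
by rewrite fctE opprK max_l//; near: t; exact: nbhs_pinfty_ge.
Unshelve. all: end_near. Qed.

(** A positive rate gives p h S T > 0 for some small h, kept fixed while t grows. By [dirichlet_le]
    the squared difference is at most a constant times a difference of two values of the return
    density, both tending to [L]. *)
Lemma density_edge S T (L : R) : 0 < jump_rate lambda mu S T ->
  u t o @[t --> +oo] --> L -> u t S - u t T @[t --> +oo] --> 0.
Proof.
move=> J uL.
have ST : S != T by apply: contraTneq J => ->; rewrite jump_rate_diag ltxx.
have [h h0 ph] : exists2 h, 0 < h & 0 < p h S T.
  have := transition_derivative pQ (S := S) (T := T).
  rewrite /Qmatrix eq_sym (negbTE ST) (transition0 pQ) (negbTE ST).
  move=> /(cvgr_gt _)/(_ _ J) H.
  near (0 : R)^'+ => h; exists h => //.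
  have : 0 < (p h S T - 0) / h by near: h.
  by rewrite subr0 pmulr_lgt0// invr_gt0.
have tt : t + t @[t --> +oo] --> (+oo : set_system R).
  apply/cvgryPge => A; near=> t.
  apply: (@le_trans _ _ t).
    by near: t; apply: nbhs_pinfty_ge; exact: num_real.
  by rewrite lerDl; near: t; exact: nbhs_pinfty_ge.
have u2L : u (t + t) o @[t --> +oo] --> L by apply: cvg_comp tt uL.
have u2hL : u (t + t + h) o @[t --> +oo] --> L.
  apply: (@cvg_comp _ _ _ (fun t => t + t + h) (u^~ o) _ +oo) => //.
  by apply: cvg_comp tt (cvg_addrr h).
have pip : 0 < pi S * p h S T by exact: mulr_gt0.
pose c := (pi S * p h S T)^-1 * 2.
have c0 : 0 <= c by rewrite mulr_ge0// invr_ge0 mulr_ge0// ltW.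
have sq0 : (u t S - u t T) ^+ 2 @[t --> +oo] --> 0.
  apply: (@squeeze_cvgr _ _ _ _ (fun=> 0)
    (fun t => c * (u (t + t) o - u (t + t + h) o))).
  - near=> t; rewrite sqr_ge0 /= /c -mulrA ler_pdivlMl//.
    apply: dirichlet_le; first exact: ltW.
    by near: t; exact: nbhs_pinfty_ge.
  - exact: cvg_cst.
  - rewrite -(mulr0 c) -(subrr L); apply: cvgMr; exact: cvgB.
have : `|u t S - u t T| @[t --> +oo] --> 0.
  rewrite -(@sqrtr0 R).
  rewrite (_ : (fun t => _) = (fun t => Num.sqrt ((u t S - u t T) ^+ 2))).
    by apply: cvg_comp sq0 _; exact: sqrt_continuous.
  by apply/funext => t; rewrite sqrtr_sqr.
exact: norm_cvg0.
Unshelve. all: end_near. Qed.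

End Convergence.

Section Limit.
Variables (R : realType) (lambda mu r : R).
Hypotheses (lambda_gt0 : 0 < lambda) (mu_gt0 : 0 < mu).
Hypothesis rE : r * expR (- r) = lambda / mu.
Hypothesis r_min : forall s, s * expR (- s) = lambda / mu -> r <= s.
Local Notation pi := (stationary lambda mu r).
Let pi_gt0 T : 0 < pi T. Proof. exact: stationary_gt0. Qed.

Variable p : R -> tree -> tree -> R.
Hypothesis pQ : is_transition_function (Qmatrix lambda mu) p.
Local Notation u := (density lambda mu r p root_tree).

(** Deletions alone connect every tree to the root tree, so induction on the volume suffices. *)
Lemma density_cvg_all (L : R) S :
  u t root_tree @[t --> +oo] --> L -> u t S @[t --> +oo] --> L.
Proof.
move=> uL; have [n] := ubnP (volume S); elim: n S => // n IH S Sn.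
have [S1|S1] := leqP (volume S) 1; first by rewrite (volume_le1 S1).
have [T TS J] := exists_jump lambda_gt0 mu_gt0 S1.
have uT : u t T @[t --> +oo] --> L by apply: IH; rewrite -ltnS TS.
have := density_edge lambda_gt0 mu_gt0 rE r_min pQ J uL.
move=> /cvgD/(_ uT); rewrite add0r; apply: cvg_trans.
by apply: near_eq_cvg; near=> t; rewrite subrK.
Unshelve. all: end_near. Qed.

Lemma stationary_exhaust eps : 0 < eps ->
  exists2 W : seq tree, uniq W & 1 - eps < \sum_(T <- W) pi T.
Proof.
move=> e0; apply: contrapT => noW.
have : (\esum_(T in [set: tree]) (pi T)%:E <= (1 - eps)%:E)%E.
  apply: ub_ereal_sup => _ [X [/finite_seqP[s ->] _] <-].
  have -> : [set` s] = [set` undup s].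
    by apply/seteqP; split => x /=; rewrite mem_undup.
  rewrite -fsbig_seq ?undup_uniq// sumEFin lee_fin leNgt.
  by apply/negP => ?; apply: noW; exists (undup s); rewrite ?undup_uniq.
rewrite (esum_stationary1 lambda_gt0 mu_gt0 rE r_min) lee_fin; lra.
Qed.

Lemma transition_cvg S : p t root_tree S @[t --> +oo] --> pi S.
Proof.
have [L uL] := density_cvg lambda_gt0 mu_gt0 rE r_min pQ root_tree.
have pE t T : p t root_tree T = pi T * u t T.
  by rewrite /density mulrC divfK// lt0r_neq0.
have pL T : p t root_tree T @[t --> +oo] --> pi T * L.
  under eq_fun do rewrite pE; apply: cvgMr; exact: density_cvg_all.
have sumL (W : seq tree) :
    \sum_(T <- W) p t root_tree T @[t --> +oo] --> (\sum_(T <- W) pi T) * L.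
  rewrite mulr_suml; apply: cvg_big => [|i _]; last exact: pL.
  exact: add_continuous.
pose c := (pi root_tree)^-1.
have c0 : 0 < c by rewrite invr_gt0.
have pc t T : 0 <= t -> p t root_tree T <= c * pi T.
  move=> t0; rewrite pE (density_rev lambda_gt0 mu_gt0 rE r_min pQ)// mulrC.
  rewrite ler_pM2r//; apply: ler_piMl; [exact: ltW|exact: (transition_le1 pQ)].
have upper (W : seq tree) : uniq W -> (\sum_(T <- W) pi T) * L <= 1.
  move=> uW; apply: cvgr_to_le (sumL W) _; near=> t.
  by apply: (transition_sum_le1 pQ) => //; near: t; exact: nbhs_pinfty_ge.
have pi1 (W : seq tree) : uniq W -> \sum_(T <- W) pi T <= 1.
  move=> uW; rewrite -lee_fin -(esum_stationary1 lambda_gt0 mu_gt0 rE r_min).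
  by rewrite -sumEFin; apply: esum_fin_ge => // T; rewrite lee_fin ltW.
(* Tightness: by [pc] the mass of p t outside [W] is at most [c] times that of pi, uniformly in
   t. *)
have lower (W : seq tree) : uniq W ->
    1 - c * (1 - \sum_(T <- W) pi T) <= (\sum_(T <- W) pi T) * L.
  move=> uW; apply: cvgr_to_ge (sumL W) _; near=> t.
  have t0 : 0 <= t by near: t; exact: nbhs_pinfty_ge.
  rewrite lerBlDr -lerBlDl -lee_fin.
  have mass_compl (f : tree -> R) : (forall V, 0 <= f V) ->
      (\esum_(V in [set: tree]) (f V)%:E = 1 ->
       (1 - \sum_(V <- W) f V)%:E = \esum_(V in ~` [set` W]) (f V)%:E)%E.
    move=> f0; rewrite (esum_split uW)//; set Y := esum _ _.
    by case: Y => // y; rewrite -EFinD => -[<-]; rewrite addrAC subrr add0r.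
  rewrite (mass_compl (p t root_tree)); first last.
  - exact: (transition_sum1 pQ).
  - by move=> V; exact: (transition_ge0 pQ).
  rewrite EFinM (mass_compl pi); first last.
  - exact: esum_stationary1.
  - by move=> V; exact: ltW.
  rewrite -esumZl ?(ltW c0)//; last by move=> V; rewrite lee_fin ltW.
  by apply: le_esum => V _; rewrite lee_fin pc.
suff L1 : L = 1 by have := pL S; rewrite L1 mulr1.
have L0 : 0 <= L.
  apply: cvgr_to_ge uL _; near=> t.
  apply: (density_ge0 lambda_gt0 mu_gt0 rE r_min pQ).
  by near: t; exact: nbhs_pinfty_ge.
apply/eqP; rewrite eq_le; apply/andP; split; apply/ler_addgt0Pr => eps e0.
  have d0 : 0 < eps / (L + 1) by rewrite divr_gt0// ltr_wpDl.
  have [W uW sW] := stationary_exhaust d0.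
  have sL : L - eps <= (1 - eps / (L + 1)) * L.
    rewrite mulrBl mul1r lerD2l lerN2 mulrAC ler_pdivrMr ?ltr_wpDl//.
    by rewrite ler_pM2l// lerDl.
  have := upper W uW; have := ler_wpM2r L0 (ltW sW); lra.
have d0 : 0 < eps / c by rewrite divr_gt0.
have [W uW sW] := stationary_exhaust d0.
have cW : c * (1 - \sum_(T <- W) pi T) <= eps.
  by rewrite -ler_pdivlMl// mulrC; lra.
have sLL : (\sum_(T <- W) pi T) * L <= L by rewrite ler_piMl// pi1.
have := lower W uW; lra.
Unshelve. all: end_near. Qed.

End Limit.

(** * Convergence in distribution on the integers *)

Section MassFunction.
Variable R : realType.
Implicit Types (q nu g : nat -> R).

Definition is_mass q := (forall k, 0 <= q k) /\
  (\esum_(k in [set: nat]) (q k)%:E = 1)%E.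

Definition mass_mean g q : R := fine (\esum_(k in [set: nat]) (g k * q k)%:E).

Lemma mass_mean_bounds g q (c : R) n : is_mass q -> (forall k, 0 <= g k <= c) ->
  (\esum_(k in [set: nat]) (g k * q k)%:E = (mass_mean g q)%:E)%E /\
  \sum_(k < n) g k * q k <= mass_mean g q <=
  \sum_(k < n) g k * q k + c * (1 - \sum_(k < n) q k).
Proof.
move=> [q0 q1] gc.
have g0 k : 0 <= g k by have /andP[] := gc k.
have gq0 k : 0 <= g k * q k by rewrite mulr_ge0.
have c0 : 0 <= c by have /andP[/le_trans] := gc 0%N; apply.
have split_n (f : nat -> R) : (forall k, 0 <= f k) ->
    (\esum_(k in [set: nat]) (f k)%:E =
     (\sum_(k < n) f k)%:E + \esum_(k in ~` `I_n) (f k)%:E)%E.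
  move=> f0; rewrite (esumID `I_n) ?setTI => [|k _]; last by rewrite lee_fin.
  congr (_ + _)%E.
  rewrite esum_fset; [|exact: finite_II|by move=> k _; rewrite lee_fin].
  by rewrite -(big_mkord xpredT f) -sumEFin -fsbig_ord big_mkord.
have tail : (\esum_(k in ~` `I_n) (g k * q k)%:E <=
    c%:E * \esum_(k in ~` `I_n) (q k)%:E)%E.
  rewrite -esumZl//; apply: le_esum => k _; rewrite lee_fin ler_wpM2r//.
  by have /andP[] := gc k.
have tail0 : (0 <= \esum_(k in ~` `I_n) (g k * q k)%:E)%E.
  by apply: esum_ge0 => k _; rewrite lee_fin.
have tailq0 : (0 <= \esum_(k in ~` `I_n) (q k)%:E)%E.
  by apply: esum_ge0 => k _; rewrite lee_fin.
rewrite /mass_mean; move: q1; rewrite !split_n//; move: tail tail0 tailq0.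
set X := esum _ _; set Y := esum _ _.
case: Y => [y| |]//.
case: X => [x| |]//; rewrite -EFinM !lee_fin => xy x0 _ [yE]; split => //=.
by rewrite lerDl x0 lerD2l (le_trans xy)// -yE addrAC subrr add0r.
Qed.

(** No mass is lost in the limit because [nu] has total mass 1. The mean lies between a finite sum
    and that sum plus [c] times the missing mass; both bounds converge, to limits at most eps / 2
    apart. *)
Lemma mass_mean_cvg (q : R -> nat -> R) nu g (c : R) :
  (forall t, 0 <= t -> is_mass (q t)) -> is_mass nu ->
  (forall k, 0 <= g k <= c) ->
  (forall k, q t k @[t --> +oo] --> nu k) ->
  mass_mean g (q t) @[t --> +oo] --> mass_mean g nu.
Proof.
move=> qm num gc qnu; apply/cvgrPdist_le => eps e0.
have c0 : 0 <= c by have /andP[/le_trans] := gc 0%N; apply.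
have [n nE] : exists n, c * (1 - \sum_(k < n) nu k) <= eps / 2.
  have : (\sum_(k < n) nu k) @[n --> \oo] --> (1 : R).
    have [nu0 nu1] := num; rewrite -nneseries_esumT in nu1; last first.
      by move=> k; rewrite lee_fin.
    have H : (\sum_(0 <= k < n) (nu k)%:E)%E @[n --> \oo] --> 1%:E.
      by rewrite -nu1; apply: is_cvg_nneseries => k _ _; rewrite lee_fin.
    have [_] := (fine_cvgP _ _).1 H; apply: cvg_trans; apply: near_eq_cvg.
    by near=> m; rewrite /= sumEFin /= big_mkord.
  move=> /cvgrPdist_le /(_ (eps / 2 / (c + 1))) [].
    by rewrite !divr_gt0// ltr_wpDl.
  move=> n _ /(_ n (leqnn n)) H; exists n.
  apply: (@le_trans _ _ (c * (eps / 2 / (c + 1)))).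
    by rewrite ler_wpM2l// (le_trans (ler_norm _)).
  rewrite mulrCA ler_piMr ?divr_ge0 ?(ltW e0)//.
  by rewrite ler_pdivrMr ?mul1r ?lerDl// ltr_wpDl.
have sum_cvg (f : nat -> R) : \sum_(k < n) f k * q t k @[t --> +oo] -->
    \sum_(k < n) f k * nu k.
  apply: cvg_big => [|k _]; first exact: add_continuous.
  by apply: cvgMr; exact: qnu.
have lo : \sum_(k < n) g k * q t k @[t --> +oo] --> \sum_(k < n) g k * nu k.
  exact: sum_cvg.
have up : \sum_(k < n) g k * q t k + c * (1 - \sum_(k < n) 1 * q t k)
    @[t --> +oo] --> \sum_(k < n) g k * nu k + c * (1 - \sum_(k < n) 1 * nu k).
  apply: cvgD => //; apply: cvgMr; apply: cvgB; first exact: cvg_cst.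
  exact: (sum_cvg (fun=> 1)).
have e2 : 0 < eps / 2 by rewrite divr_gt0.
have [_ /andP[lo_nu up_nu]] := mass_mean_bounds n num gc.
near=> t.
have t0 : 0 <= t by near: t; exact: nbhs_pinfty_ge.
have [_ /andP[lo_t up_t]] := mass_mean_bounds n (qm t t0) gc.
have lo' : `|\sum_(k < n) g k * nu k - \sum_(k < n) g k * q t k| <= eps / 2.
  by near: t; move/cvgrPdist_le: lo; apply.
have up' : `|(\sum_(k < n) g k * nu k + c * (1 - \sum_(k < n) 1 * nu k)) -
    (\sum_(k < n) g k * q t k + c * (1 - \sum_(k < n) 1 * q t k))| <= eps / 2.
  by near: t; move/cvgrPdist_le: up; apply.
have sum1 (f : nat -> R) : \sum_(k < n) 1 * f k = \sum_(k < n) f k.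
  by apply: eq_bigr => k _; rewrite mul1r.
move: lo' up'; rewrite !sum1 !ler_norml => /andP[_ lo'] /andP[up' _].
apply/andP; split; lra.
Unshelve. all: end_near. Qed.

(** The proof [qm] is an argument so that the measure and probability structures below can be
    attached to this constant. *)
Definition mass_measure q (qm : is_mass q) (U : set nat) : \bar R :=
  \esum_(k in U) (q k)%:E.

Section MassMeasure.
Variables (q : nat -> R) (qm : is_mass q).
Local Open Scope ereal_scope.
Local Notation mu := (mass_measure qm).

Let mass0 : mu set0 = 0. Proof. exact: esum_set0. Qed.

Let mass_ge0 U : 0 <= mu U.
Proof. by apply: esum_ge0 => k _; rewrite lee_fin; case: qm. Qed.

Let mass_sigma_additive : semi_sigma_additive mu.
Proof.
move=> F mF tF mUF; apply: cvg_toP.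
  apply: ereal_nondecreasing_is_cvgn => a b ab.
  by apply: lee_sum_nneg_natr => // n _ _; exact: mass_ge0.
by rewrite /mass_measure nneseries_sum_bigcup// => k; rewrite lee_fin; case: qm.
Qed.

HB.instance Definition _ := isMeasure.Build _ _ _ mu
  mass0 mass_ge0 mass_sigma_additive.

Let mass_setT : mu [set: nat] = 1. Proof. by case: qm. Qed.

HB.instance Definition _ := @Measure_isProbability.Build _ _ R mu mass_setT.

Lemma mass_measure1 k : mu [set k] = (q k)%:E.
Proof. by rewrite /mass_measure esum_set1// lee_fin; case: qm. Qed.

End MassMeasure.

Section CountablyValued.
Context d (Omega : measurableType d) (P : probability Omega R).
Local Open Scope ereal_scope.

(** The cells need only cover a set of probability 1: the limit variable is real valued and an
    integer only almost surely. *)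
Lemma ge0_integral_partition (F : (set Omega)^nat) (c : nat -> R)
    (g : Omega -> R) :
  (forall k, measurable (F k)) -> trivIset setT F -> P (\bigcup_k F k) = 1 ->
  measurable_fun setT g -> (forall w, 0 <= g w)%R ->
  (forall k w, F k w -> g w = c k) ->
  \int[P]_w (g w)%:E = \esum_(k in [set: nat]) ((c k)%:E * P (F k)).
Proof.
move=> mF tF PF mg g0 gF.
have mU : measurable (\bigcup_k F k) by exact: bigcup_measurable.
rewrite (@ge0_negligible_integral _ _ _ _ _ (~` \bigcup_k F k))//; first last.
- by have := probability_setC P mU; rewrite PF subee.
- by move=> w _; rewrite lee_fin.
- exact/measurable_EFinP.
- exact: measurableC.
rewrite setDE setCK setTI ge0_integral_bigcup//; first last.
- by move=> w _; rewrite lee_fin.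
- by apply: measurable_funTS; exact/measurable_EFinP.
have intF k : \int[P]_(w in F k) (g w)%:E = (c k)%:E * P (F k).
  rewrite -integral_cst//; apply: eq_integral => w; rewrite inE => Fw.
  by rewrite (gF k).
rewrite -nneseries_esumT; last first.
  by move=> k; rewrite -intF; apply: integral_ge0 => w _; rewrite lee_fin.
by apply: eq_eseriesr => k _; exact: intF.
Qed.

Section NatValued.
Variable X : Omega -> nat.
Hypothesis mX : forall k, measurable (X @^-1` [set k]).

Lemma measurable_nat_valued (g : nat -> R) : measurable_fun setT (g \o X).
Proof.
move=> _ Y mY; rewrite setTI.
rewrite (_ : _ @^-1` Y = \bigcup_(k in [set k | Y (g k)]) (X @^-1` [set k])).
  exact: bigcup_measurable.
apply/seteqP; split => w /=; first by move=> Yw; exists (X w).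
by move=> [k /= Yk Xk]; rewrite Xk.
Qed.

Lemma bigcup_fibers : \bigcup_k (X @^-1` [set k]) = setT.
Proof. by apply/seteqP; split => // w _; exists (X w). Qed.

Lemma trivIset_fibers : trivIset setT (fun k => X @^-1` [set k]).
Proof. by move=> i j _ _ [w [/= <- <-]]. Qed.

Definition law (k : nat) : R := fine (P (X @^-1` [set k])).

Lemma lawE k : P (X @^-1` [set k]) = (law k)%:E.
Proof. by rewrite /law fineK// fin_num_measure. Qed.

Lemma law_is_mass : is_mass law.
Proof.
split=> [k|]; first by rewrite fine_ge0.
transitivity (\esum_(k in [set: nat]) (1%:E * P (X @^-1` [set k]))).
  by apply: eq_esum => k _; rewrite mul1e lawE.
rewrite -(@ge0_integral_partition _ _ (fun=> 1%R))//.
- by rewrite integral_cst// mul1e; exact: probability_setT.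
- exact: trivIset_fibers.
- by rewrite bigcup_fibers probability_setT.
Qed.

(** Adding [c] makes the function nonnegative, as unordered sums require; it is subtracted at the
    end. *)
Lemma expectation_nat_valued (g : nat -> R) (c : R) :
  (forall k, `|g k| <= c)%R ->
  'E_P[g \o X] = (mass_mean (fun k => g k + c) law - c)%:E.
Proof.
move=> gc.
have gc2 k : (0 <= g k + c <= c + c)%R.
  have := gc k; rewrite ler_norml => /andP[lo up].
  by rewrite lerD2r up andbT -lerBlDr sub0r.
have [E _] := mass_mean_bounds 0 law_is_mass gc2.
have int_g : P.-integrable setT (EFin \o (g \o X)).
  apply: measurable_bounded_integrable => //.
  - exact: le_lt_trans (probability_le1 P measurableT) (ltry 1).
  - exact: measurable_nat_valued.
  - exists c; split; first exact: num_real.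
    by move=> x cx w _ /=; rewrite (le_trans (gc _))// ltW.
have int_c : P.-integrable setT (EFin \o cst c).
  exact: finite_measure_integrable_cst.
have : \int[P]_w ((g (X w) + c)%:E) = (mass_mean (fun k => g k + c) law)%:E.
  rewrite -E (@ge0_integral_partition (fun k => X @^-1` [set k])
    (fun k => g k + c)%R)//.
  - by apply: eq_esum => k _; rewrite lawE.
  - exact: trivIset_fibers.
  - by rewrite bigcup_fibers probability_setT.
  - exact: (measurable_nat_valued (fun k => g k + c)%R).
  - by move=> w; have /andP[] := gc2 (X w).
  - by move=> k w /= ->.
rewrite unlock EFinB => <-.
have := @integralD_EFin _ _ _ P setT measurableT _ _ int_g int_c.
rewrite /= => ->; rewrite integral_cst// [X in (_ * X)%E](_ : _ = 1).
  by rewrite mule1 addeK.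
exact: probability_setT.
Qed.

End NatValued.
End CountablyValued.
End MassFunction.

(** * Atoms of a law seen through continuous test functions *)

Section Tent.
Variable R : realType.
Implicit Types (m k : nat) (x : R).

(* The positive part of 1 - m |x - k|. *)
Definition tent m k x : R :=
  let y := 1 - m%:R * `|x - k%:R| in (`|y| + y) / 2.

Lemma tent_bounds m k x : 0 <= tent m k x <= 1.
Proof.
rewrite /tent; have a0 : 0 <= m%:R * `|x - k%:R| by rewrite mulr_ge0.
move: a0; set a := m%:R * _ => a0.
by case: (lerP 0 (1 - a)) => a1; [rewrite ger0_norm//|rewrite ltr0_norm//];
  apply/andP; split; lra.
Qed.

Lemma tent_center m k : tent m k k%:R = 1.
Proof. by rewrite /tent subrr normr0 mulr0 subr0 normr1; lra. Qed.

Lemma tent_far m k x : 1 <= m%:R * `|x - k%:R| -> tent m k x = 0.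
Proof.
by move=> a1; rewrite /tent ler0_norm ?subr_le0// addNr mul0r.
Qed.

(** Slope at least 1 makes the tent vanish at the other integers, so integer variables give the same
    mean to every width. *)
Lemma tent_nat m k j : tent m.+1 k j%:R = (j == k)%:R.
Proof.
have [->|jk] := eqVneq; first exact: tent_center.
suff jk1 : 1 <= `|j%:R - k%:R| :> R.
  by rewrite tent_far// (le_trans jk1)// ler_peMl// ler1n.
case: (ltngtP j k) jk => // jk _; first rewrite distrC.
  by rewrite -natrB 1?ltnW// normr_nat ler1n subn_gt0.
by rewrite -natrB 1?ltnW// normr_nat ler1n subn_gt0.
Qed.

Lemma continuous_tent m k : continuous (tent m k).
Proof.
have cy : continuous (fun x => 1 - m%:R * `|x - k%:R| : R).
  move=> x; apply: cvgB; first exact: cvg_cst.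
  apply: cvgMr; apply: cvg_norm; apply: cvgB => //; exact: cvg_cst.
move=> x; apply: cvgMl; apply: cvgD; last exact: cy.
by apply: cvg_norm; exact: cy.
Qed.

End Tent.

Section Identification.
Variable R : realType.
Variables (d : measure_display) (Omega : measurableType d).
Variables (P : probability Omega R) (Y : {RV P >-> R}) (nu : nat -> R).
Hypothesis num : is_mass nu.
Local Open Scope ereal_scope.

(** The tents lie above the indicator of k and below that of the ball of radius 1 / (m + 1). With
    all means equal to nu k, this gives P(Y = k) <= nu k <= P(|Y - k| < 1 / (m + 1)), which
    decreases to P(Y = k). That [Y] is an integer is not presupposed. *)
Lemma expectation_tent_law k :
  (forall m, 'E_P[tent m.+1 k \o Y] = (nu k)%:E) ->
  P (Y @^-1` [set k%:R]) = (nu k)%:E.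
Proof.
move=> Etent; have mY : measurable_fun setT Y by exact: measurable_funPT.
have mpre (A : set R) : measurable A -> measurable (Y @^-1` A).
  by move=> mA; rewrite -[X in measurable X]setTI; exact: mY.
have mb m : measurable_fun setT (tent m.+1 k \o Y).
  apply: measurableT_comp mY; apply: continuous_measurable_fun.
  exact: continuous_tent.
have b01 m (x : R) : (0 <= tent m k x <= 1)%R by exact: tent_bounds.
have mk : measurable (Y @^-1` [set k%:R]).
  by apply: (mpre [set k%:R]); exact: measurable_set1.
apply/eqP; rewrite eq_le; apply/andP; split.
  rewrite -(Etent 0%N) -expectation_indic//; apply: expectation_le => //.
  - by move=> w; have /andP[] := b01 1%N (Y w).
  - apply: aeW => w; rewrite indicE; case: (boolP (w \in _)) => [|_].
      by rewrite inE /= => ->; rewrite tent_center.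
    by have /andP[] := b01 1%N (Y w).
pose F m := Y @^-1` [set x | `|x - k%:R| < m.+1%:R^-1]%R.
have mF m : measurable (F m).
  apply: mpre; apply: open_measurable.
  rewrite (_ : [set x | _] = ball (k%:R : R) (m.+1%:R^-1)%R).
    by apply: ball_open; rewrite invr_gt0.
  by apply/seteqP; split => x; rewrite /ball /= distrC.
have capF : \bigcap_m F m = Y @^-1` [set k%:R].
  apply/seteqP; split => w /=; last first.
    by move=> Yw m _; rewrite /F /= Yw subrr normr0 invr_gt0.
  move=> Fw; apply/eqP; rewrite -subr_eq0 -normr_le0.
  apply/ler_addgt0Pr => e e0; rewrite add0r.
  have := Fw (Num.truncn e^-1)%R I; rewrite /F /= => /ltW/le_trans; apply.
  by rewrite -[leRHS]invrK lef_pV2 ?posrE ?invr_gt0// ltW// truncnS_gt.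
have : (P \o F) @ \oo --> P (\bigcap_m F m).
  apply: nonincreasing_cvg_mu => //.
  - exact: le_lt_trans (probability_le1 P (mF _)) (ltry 1).
  - by rewrite capF.
  - move=> n m nm; apply/subsetPset => w; rewrite /F /= => /lt_le_trans; apply.
    by rewrite lef_pV2 ?posrE// ler_nat.
rewrite capF => H; apply: (cvge_to_ge H); near=> m.
rewrite -(Etent m) /= -expectation_indic//; apply: expectation_le => //.
- by move=> w; have /andP[] := b01 m.+1 (Y w).
- apply: aeW => w; rewrite indicE; case: (boolP (w \in _)) => [_|].
    by have /andP[] := b01 m.+1 (Y w).
  rewrite notin_setE /F /= => /negP; rewrite -leNgt => kY.
  by rewrite tent_far// -ler_pdivrMl// mulr1.
Unshelve. all: end_near. Qed.

(** The masses sum to 1, so [Y] is almost surely a natural number and equals |Y|; the integral is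
    then that of a nonnegative function, which also covers an infinite mean. *)
Lemma expectation_of_law :
  (forall k, P (Y @^-1` [set k%:R]) = (nu k)%:E) ->
  'E_P[Y] = \esum_(k in [set: nat]) (k%:R * nu k)%:E.
Proof.
move=> lawY; have mY : measurable_fun setT Y by exact: measurable_funPT.
pose F k := Y @^-1` [set k%:R : R].
have mF k : measurable (F k).
  by rewrite -[X in measurable X]setTI; apply: mY => //; exact: measurable_set1.
have tF : trivIset setT F.
  move=> i j _ _ [w [Fi Fj]]; apply/eqP; rewrite -(eqr_nat R); apply/eqP.
  by transitivity (Y w).
have mU : measurable (\bigcup_k F k) by exact: bigcup_measurable.
have PF : P (\bigcup_k F k) = 1.
  rewrite measure_semi_bigcup//; have [nu0 <-] := num.
  rewrite -nneseries_esumT => [|k]; last by rewrite lee_fin.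
  by apply: eq_eseriesr => k _; exact: lawY.
have mnY : measurable_fun setT (fun w => `|Y w|%R) by exact: measurableT_comp.
rewrite unlock (ae_eq_integral (fun w => `|Y w|%:E))//.
- rewrite (@ge0_integral_partition _ _ _ P F (fun k => k%:R))//.
    by apply: eq_esum => k _; rewrite lawY.
  by move=> k w /= ->; rewrite normr_nat.
- exact/measurable_EFinP.
- exact/measurable_EFinP.
exists (~` \bigcup_k F k); split.
- exact: measurableC.
- by have := probability_setC P mU; rewrite PF subee.
- move=> w /= H [k _ Fw]; apply: H => _; move: Fw; rewrite /F /= => ->.
  by rewrite normr_nat.
Qed.

End Identification.

(** * Law of the volume process and its limit *)

Section VolumeLimit.
Variables (R : realType) (lambda mu r : R).
Hypotheses (lambda_gt0 : 0 < lambda) (mu_gt0 : 0 < mu).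
Hypothesis rE : r * expR (- r) = lambda / mu.
Hypothesis r_min : forall s, s * expR (- s) = lambda / mu -> r <= s.
Local Notation pi := (stationary lambda mu r).
Local Notation nu := (volume_law lambda mu r).

Variables (d : measure_display) (Omega : measurableType d).
Variables (P : probability Omega R) (G : R -> Omega -> tree).
Hypothesis G_tree : is_birth_death_tree P lambda mu G.

Lemma volume_law_is_mass : is_mass nu.
Proof.
split=> [k|]; first exact: (volume_law_ge0 lambda_gt0 mu_gt0 rE r_min).
exact: (esum_volume_law1 lambda_gt0 mu_gt0 rE r_min).
Qed.

Let fiberG t T : set Omega := G t @^-1` [set T].

(** The finite-dimensional laws give the probability of being at the root tree at time 0 and at [T]
    at time t; the first event has probability 1 by the case n = 0. *)
Lemma Markov_chain_marginal : exists2 p : R -> tree -> tree -> R,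
  is_transition_function (Qmatrix lambda mu) p &
  forall t T, 0 <= t -> P (fiberG t T) = (p t root_tree T)%:E.
Proof.
case: G_tree => mG [p pQ fdd]; exists p => // t T t0.
have mg s S : 0 <= s -> measurable (fiberG s S) by exact: mG.
have P0 : P (fiberG 0 root_tree) = 1%E.
  have := fdd 0%N (fun=> 0) (fun=> root_tree) erefl (fun=> lexx _) erefl.
  rewrite big_ord0 => <-; congr (P _); apply/seteqP; split => w /=.
    by move=> Gw i.
  by move=> /(_ 0%N (leqnn _)).
(* The times 0, t, t, ... are nondecreasing at every index, as [fdd] requires. *)
have := fdd 1%N (fun i => if i is 0%N then 0 else t)
  (fun i => if i is 0%N then root_tree else T) erefl.
move=> /(_ _ erefl); rewrite big_ord1 subr0 => <-; last first.
  by case=> [|i].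
rewrite (_ : [set w | _] = fiberG t T `&` fiberG 0 root_tree); last first.
  apply/seteqP; split => w /= => [Gw|[Gt G0] [|[|i]]//].
  by split; [exact: (Gw 1%N)|exact: (Gw 0%N)].
have [mT mR] := (mg t T t0, mg 0 root_tree (lexx _)).
rewrite (measureDI P mT mR) [X in (X + _)%E](_ : _ = 0%E) ?add0e//.
apply: (@subset_measure0 _ _ _ _ _ (~` fiberG 0 root_tree)) => //.
- exact: measurableD.
- exact: measurableC.
- by have := probability_setC P mR; rewrite P0 subee//; apply: eq_trans.
Qed.

Let X t w := volume (G t w).

Lemma volume_fiber t k : X t @^-1` [set k] =
  \bigcup_(T in [set T | volume T = k]) fiberG t T.
Proof.
apply/seteqP; split => w /= => [<-|[T /= <- GT]]; first by exists (G t w).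
by rewrite /X (GT : G t w = T).
Qed.

Lemma measurable_volume_fiber t k : 0 <= t -> measurable (X t @^-1` [set k]).
Proof.
move=> t0; rewrite volume_fiber; apply: fin_bigcup_measurable.
  apply: sub_finite_set (finite_volume_le lambda_gt0 mu_gt0 rE r_min k).
  by move=> T /= ->.
by move=> T _; case: G_tree => mG _; exact: mG.
Qed.

(** There are finitely many trees of volume k, so the limits of their probabilities may be added. *)
Lemma volume_cvg k : law P (X t) k @[t --> +oo] --> nu k.
Proof.
have [p pQ pG] := Markov_chain_marginal.
have finD : finite_set [set T | volume T = k].
  apply: sub_finite_set (finite_volume_le lambda_gt0 mu_gt0 rE r_min k).
  by move=> T /= ->.
have /finite_seqP[s0 s0E] := finD.
pose s := undup s0.
have us : uniq s by exact: undup_uniq.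
have sE : [set T | volume T = k] = [set` s].
  by rewrite s0E; apply/seteqP; split => T /=; rewrite mem_undup.
have -> : nu k = \sum_(T <- s) pi T.
  apply: EFin_inj; rewrite -(esum_volume_law lambda_gt0 mu_gt0 rE r_min) sE.
  rewrite esum_fset; [|exact: finite_seq|].
    by rewrite -fsbig_seq// sumEFin.
  by move=> T _; rewrite lee_fin ltW// stationary_gt0.
have : \sum_(T <- s) p t root_tree T @[t --> +oo] --> \sum_(T <- s) pi T.
  apply: cvg_big => [|T _]; first exact: add_continuous.
  exact: (transition_cvg lambda_gt0 mu_gt0 rE r_min pQ).
apply: cvg_trans; apply: near_eq_cvg; near=> t.
have t0 : 0 <= t by near: t; exact: nbhs_pinfty_ge.
have mG T : measurable (fiberG t T) by case: G_tree => mG _; exact: mG.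
rewrite /law volume_fiber measure_fin_bigcup//; last first.
  by move=> S T _ _ [w [/= <- <-]].
rewrite sE -fsbig_seq// (eq_bigr (fun T => (p t root_tree T)%:E)).
  by rewrite sumEFin.
by move=> T _; exact: pG.
Unshelve. all: end_near. Qed.

Lemma expectation_volume_cvg (f : R -> R) (c : R) : (forall x, `|f x| <= c) ->
  'E_P[f \o (fun w => (X t w)%:R)]%E @[t --> +oo] -->
  (mass_mean (fun k => f k%:R + c) nu - c)%:E.
Proof.
move=> fc; pose g k := f k%:R.
have gc2 k : 0 <= g k + c <= c + c.
  have := fc k%:R; rewrite ler_norml /g => /andP[lo up].
  by rewrite lerD2r up andbT -lerBlDr sub0r.
have lawm t : 0 <= t -> is_mass (law P (X t)).
  by move=> t0; apply: law_is_mass => k; exact: measurable_volume_fiber.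
have H : mass_mean (fun k => g k + c) (law P (X t)) - c @[t --> +oo] -->
    mass_mean (fun k => g k + c) nu - c.
  apply: cvgB; last exact: cvg_cst.
  by apply: mass_mean_cvg lawm volume_law_is_mass gc2 _; exact: volume_cvg.
have {}H : (mass_mean (fun k => g k + c) (law P (X t)) - c)%:E @[t --> +oo] -->
    (mass_mean (fun k => g k + c) nu - c)%:E.
  by apply: cvg_EFin; [exact: nearW|exact: H].
apply: cvg_trans H; apply: near_eq_cvg; near=> t.
have t0 : 0 <= t by near: t; exact: nbhs_pinfty_ge.
have mX k : measurable (X t @^-1` [set k]) by exact: measurable_volume_fiber.
by rewrite -(expectation_nat_valued P mX (g := g) (fun k => fc k%:R)).
Unshelve. all: end_near. Qed.

End VolumeLimit.

Lemma mass_mean_indicator (R : realType) (q : nat -> R) k : is_mass q ->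
  mass_mean (fun j => (j == k)%:R + 1) q = q k + 1.
Proof.
move=> [q0 q1]; rewrite /mass_mean.
rewrite (_ : esum _ _ = (q k)%:E + 1)%E; first by rewrite -EFinD.
transitivity (\esum_(j in [set: nat]) (((j == k)%:R * q j)%:E + (q j)%:E))%E.
  by apply: eq_esum => j _; rewrite -EFinD mulrDl mul1r.
rewrite esumD; last 2 first.
- by move=> j _; rewrite lee_fin mulr_ge0.
- by move=> j _; rewrite lee_fin.
rewrite q1 (@esum_unique _ _ _ k); first by rewrite eqxx mul1r.
- by move=> j; rewrite lee_fin mulr_ge0.
- by move=> j /negbTE ->; rewrite mul0r.
Qed.

Theorem theorem3p1 (R : realType) (lambda mu rho r : R)
    (d : measure_display) (Omega : measurableType d) (P : probability Omega R)
    (G : R -> Omega -> tree)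
    (lambda_gt0 : 0 < lambda) (mu_gt0 : 0 < mu)
    (rhoE : rho = lambda / mu) (rho_le : rho <= expR (- 1))
    (G_tree : is_birth_death_tree P lambda mu G)
    (r_le1 : r <= 1) (r_root : is_smallest_root rho r) :
  (exists (d' : measure_display) (Omega' : measurableType d')
          (P' : probability Omega' R) (N : {RV P' >-> R}),
     is_stationary_volume P G P' N) /\
  (forall (d' : measure_display) (Omega' : measurableType d')
          (P' : probability Omega' R) (N : {RV P' >-> R}),
     is_stationary_volume P G P' N ->
     (forall k : nat, (1 <= k)%N ->
        P' (N @^-1` [set k%:R]) =
        (r^-1 * (k%:R ^+ k.-1 / k`!%:R) * rho ^+ k)%:E) /\
     ('E_P'[N])%E = if r == 1 then +oo%E else ((1 - r)^-1)%:E).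
Proof.
case: r_root; rewrite {}rhoE => rE r_min.
have num := volume_law_is_mass lambda_gt0 mu_gt0 rE r_min.
have limE := expectation_volume_cvg lambda_gt0 mu_gt0 rE r_min G_tree.
split.
  (* Existence: the inclusion of the integers into R, under the point masses [volume_law]. *)
  pose N0 (k : nat) : R := k%:R.
  have mN : measurable_fun setT N0 by move=> _ Y _.
  exists _, nat, (mass_measure num), (mfun_Sub (mem_set mN)) => f cf [M [_ Mf]].
  (* [bounded_fun] provides bounds strictly above [M], hence [M + 1]. *)
  have fc x : `|f x| <= M + 1 by apply: Mf; rewrite ?ltrDl.
  have := limE f (M + 1) fc; set l := _%:E; set l' := 'E__[_]%E.
  suff -> : l = l' by [].
  rewrite /l /l'.
  rewrite (_ : f \o _ = (fun k : nat => f k%:R) \o id)//.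
  have mid k : measurable (@id nat @^-1` [set k]) by [].
  rewrite (expectation_nat_valued _ mid (g := fun k => f k%:R) (c := M + 1))//.
  congr (_ - _)%:E; congr (mass_mean _ _); apply/funext => k.
  exact: (congr1 fine (esym (mass_measure1 num k))).
move=> d' Omega' P' N Nlim.
(* The mean of a tent along G has two limits: its mean under [N], by hypothesis, and nu k, since a
   tent is the indicator of k on the integers. Limits are unique. *)
have law_N k : P' (N @^-1` [set k%:R]) = (volume_law lambda mu r k)%:E.
  apply: expectation_tent_law => // m.
  have b1 x : `|tent m.+1 k x| <= 1 :> R.
    by have /andP[b0 b1] := tent_bounds m.+1 k x; rewrite ger0_norm.
  have := limE _ 1 b1.
  have -> : (fun j : nat => tent m.+1 k j%:R + 1) =
      (fun j => (j == k)%:R + 1 : R).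
    by apply/funext => j; rewrite tent_nat.
  rewrite mass_mean_indicator// addrK => lim1.
  have tb : bounded_fun (tent m.+1 k : R -> R).
    exists 1; split; first exact: num_real.
    by move=> x x1 y _ /=; rewrite (le_trans (b1 y))// ltW.
  have lim2 := Nlim (tent m.+1 k) (@continuous_tent _ _ _) tb.
  exact: cvg_unique (@ereal_hausdorff R) _ _ _ _ lim2 lim1.
split=> [k k1|].
  by rewrite law_N; case: k k1.
rewrite (expectation_of_law num law_N).
rewrite -(esum_stationary_volume lambda_gt0 mu_gt0 rE r_min r_le1).
(* Grouping trees by volume identifies the sum of k nu k with the stationary mean volume over
   trees. *)
rewrite [RHS](esum_fiber volume); last first.
  by move=> T; rewrite lee_fin mulr_ge0// stationary_ge0.
apply: eq_esum => k _.
rewrite EFinM -(esum_volume_law lambda_gt0 mu_gt0 rE r_min) -esumZl//.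
  by apply: eq_esum => T /= ->; rewrite -EFinM mulrC.
by move=> T; rewrite lee_fin stationary_ge0.
Qed.
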